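(* For every $D, n \in \mathbb{N}$ and every $d \in \mathbb{N}$, there exists a graph $G$ with $$ e(G) \le C\, n^{2 - 1/d} $$ edges which is $\mathcal{H}_d^D(n)$-universal, where $C = C(D, d)$ is a constant depending only on $D$ and $d$.
   Context: All graphs are finite and simple. For a graph $H$, its density is $m(H) = \max_{H' \subseteq H} e(H')/v(H')$, where $e(\cdot)$ and $v(\cdot)$ denote numbers of edges and vertices. For $d \in \mathbb{Q}$ and $n, D \in \mathbb{N}$, $\mathcal{H}_d(n)$ is the family of all graphs on $n$ vertices with density at most $d$, and $\mathcal{H}_d^D(n)$ is the family of all $H \in \mathcal{H}_d(n)$ with maximum degree at most $D$. A graph $G$ is universal for a family $\mathcal{H}$ (or $\mathcal{H}$-universal) if every $H \in \mathcal{H}$ is a (not necessarily induced) subgraph of $G$. *)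

(* Defs.v *)
From mathcomp Require Import all_boot all_order all_algebra.

Set Implicit Arguments.
Unset Strict Implicit.
Unset Printing Implicit Defensive.

Import Order.TTheory GRing.Theory Num.Theory.

Local Open Scope ring_scope.

Record sgraph := SGraph {
  vertex :> finType;
  adj : rel vertex;
  adj_sym : symmetric adj;
  adj_irr : irreflexive adj }.

Definition edges (G : sgraph) : {set {set G}} :=
  [set [set p.1; p.2] | p : G * G & adj p.1 p.2].

(* Subgraphs need not be induced: a vertex set together with a set of edges of
   G whose endpoints all lie in it. *)
Definition is_subgraph (G : sgraph) (S : {set G} * {set {set G}}) : bool :=
  (S.2 \subset edges G) && [forall e in S.2, e \subset S.1].

(* The ratios are nonnegative, so the initial value 0 only matters for the
   graph without vertices, whose density is 0 by convention. *)
Definition density (G : sgraph) : rat :=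
  \big[Num.max/0]_(S : {set G} * {set {set G}}
                   | is_subgraph S && (S.1 != set0))
    (#|S.2|%:R / #|S.1|%:R).

Definition max_degree (G : sgraph) : nat :=
  (\max_(x : G) #|[set y | adj x y]|)%N.

Definition density_family (d : rat) (n : nat) (H : sgraph) : Prop :=
  #|H| = n /\ density H <= d.

Definition bounded_density_family (d : rat) (D n : nat) (H : sgraph) : Prop :=
  density_family d n H /\ (max_degree H <= D)%N.

(* Up to isomorphism, and not necessarily induced. *)
Definition subgraph_of (H G : sgraph) : Prop :=
  exists2 f : H -> G, injective f & forall x y, adj x y -> adj (f x) (f y).

Definition universal (G : sgraph) (F : sgraph -> Prop) : Prop :=
  forall H : sgraph, F H -> subgraph_of H G.

(* Main.v *)
(* Orient H with out-degrees at most d (Hakimi: possible since every subgraph has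
   density at most d). Taking the i-th out-neighbour of each vertex writes H as a
   union of d functional graphs f_1, ..., f_d, i.e. trees with one extra edge each.

   Let m = q^h be about n^(1/d). Each f_i is cut hierarchically: a vertex gets a
   height such that only O(n s^-k) vertices have height >= k, adjacent vertices
   have heights differing by at most 1, and the vertices of height at most l fall
   into pieces of about s^l vertices which are not joined by f_i-edges. Going from
   the top level down, every piece chooses one of q labels; the word of the labels
   of the pieces containing a vertex, down to its own height, is its i-th
   coordinate, so that the words of f_i-adjacent vertices agree down to the larger
   of their heights.

   The host graph has as vertices the d-tuples of such words, a tuple of heights
   (tau_i) being repeated about q^(sum tau) / s^(max tau) times; two of them are
   adjacent if they are compatible in some coordinate. Since q < s^2,
   the numbers of edges between layers decay geometrically and the total
   is O(m^(2d-1)) = O(n^(2-1/d)). The labels can be chosen so that no tuple of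
   words is used too often: the pieces are small compared to the classes that have
   to be split evenly, and Beck-Fiala rounding, with weights growing geometrically
   in the height, has bounded error. *)
Require Import Defs.
From mathcomp Require Import all_boot all_order all_algebra.
From mathcomp Require Import reals exp.
From mathcomp Require Import lra ring zify.

Set Implicit Arguments.
Unset Strict Implicit.
Unset Printing Implicit Defensive.

Import Order.TTheory GRing.Theory Num.Theory.

(** * Orientations of bounded out-degree *)

Section Orientation.

Variable H : sgraph.

Definition orients (O : {set H * H}) := forall x y,
  ((x, y) \in O -> adj x y) /\ (adj x y -> ((x, y) \in O) (+) ((y, x) \in O)).
Definition out (O : {set H * H}) x := #|[set y | (x, y) \in O]|.

Lemma orients_asym O x y : orients O -> (x, y) \in O -> (y, x) \notin O.
Proof.
by move=> oO xy; have [/(_ xy) a /(_ a)] := oO x y; rewrite xy addTb.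
Qed.

Lemma orients_exists : exists O, orients O.
Proof.
exists [set p | adj p.1 p.2 && (enum_rank p.1 < enum_rank p.2)].
move=> x y; rewrite !inE /= (adj_sym y x); split=> [/andP[]//|xy].
rewrite xy /=; case: ltngtP => // /val_inj/enum_rank_inj e.
by move: xy; rewrite e adj_irr.
Qed.

(* Reversing the edges of a directed path only changes the out-degrees of its
   two ends. *)
Lemma reverse_path O v p : orients O -> path (fun x y => (x, y) \in O) v p ->
  uniq (v :: p) -> exists O', [/\ orients O',
    forall u, out O' u + (u == v) = out O u + (u == last v p) &
    forall x y, x \notin v :: p ->
      ((x, y) \in O') = ((x, y) \in O) /\ ((y, x) \in O') = ((y, x) \in O)].
Proof.
move=> oO; elim: p v => [|w p IH] v /=; first by exists O; split.
move=> /andP[vw pw] /andP[vp up].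
have [O1 [oO1 out1 same]] := IH w pw up.
have vw1 : (v, w) \in O1 by rewrite (proj1 (same v w vp)).
have wv1 := orients_asym oO1 vw1.
have nvw : v != w by apply/eqP => e; move: wv1 vw1; rewrite e => /negPf->.
exists ((w, v) |: (O1 :\ (v, w))); split.
- move=> x y; have [a b] := oO1 x y; split.
    rewrite !inE !xpair_eqE => /orP[/andP[/eqP-> /eqP->]|/andP[_ /a//]].
    by rewrite adj_sym; apply: (proj1 (oO1 v w)).
  move=> /b; have swap (u z : H) : ((y, x) == (u, z)) = ((x, y) == (z, u)).
    by rewrite !xpair_eqE andbC.
  rewrite !in_setU !in_set1 !in_setD1 !swap.
  have [[-> ->]|n1] := eqVneq (x, y) (w, v).
    by rewrite xpair_eqE [w == v]eq_sym (negPf nvw).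
  by have [[-> ->]|n2] := eqVneq (x, y) (v, w).
- move=> u; rewrite -(out1 u).
  have [->|uv] := eqVneq u v.
    rewrite (negPf nvw) addn0 /out.
    rewrite (cardsD1 w [set y | (v, y) \in O1]) inE vw1 addnC; congr (_ + _).
    apply: eq_card => y; rewrite !inE !xpair_eqE eqxx (negPf nvw) /=.
    by rewrite eq_sym.
  rewrite addn0; have [->|uw] := eqVneq u w.
    rewrite /out (cardsD1 v) !inE eqxx /= addnC; congr (_ + _).
    apply: eq_card => y; rewrite !inE !xpair_eqE eqxx [w == v]eq_sym (negPf nvw) /=.
    by have [->|] := eqVneq y v; rewrite ?(negPf wv1).
  rewrite addn0 /out; apply: eq_card => y.
  by rewrite !inE !xpair_eqE (negPf uv) (negPf uw).
- move=> x y; rewrite inE negb_or => /andP[xv xwp].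
  have [<- <-] := same x y xwp.
  have xw : x != w by apply: contraNneq xwp => ->; rewrite mem_head.
  by rewrite !inE !xpair_eqE (negPf xv) (negPf xw) ?andbF.
Qed.

(** Hakimi's argument: take an orientation of least total excess. A directed path from an overloaded
    vertex to one with spare out-degree could be reversed, lowering the excess; without such a path,
    the vertices reachable from the overloaded one span too many edges. *)
Lemma bounded_orientation (d : nat) : (density H <= d%:R)%R ->
  exists O, orients O /\ forall x, out O x <= d.
Proof.
move=> dens.
pose excess O := \sum_x (out O x - d).
have [O0 oO0] := orients_exists.
pose oriented := [pred O : {set H * H} | [forall x, forall y,
  (((x, y) \in O) ==> adj x y) && (adj x y ==> ((x, y) \in O) (+) ((y, x) \in O))]].
have orientedP O : reflect (orients O) (oriented O).
  apply: (iffP forallP) => [h x y|h x].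
    by have /forallP/(_ y)/andP[/implyP a /implyP b] := h x.
  apply/forallP => y; have [a b] := h x y.
  by apply/andP; split; apply/implyP.
have : oriented O0 by apply/orientedP.
case/(arg_minnP excess) => O /orientedP oO minO; exists O; split=> // v.
rewrite leqNgt; apply/negP => dv.
pose S := [set u | connect (fun x y => (x, y) \in O) v u].
have vS : v \in S by rewrite inE connect0.
have [/existsP[u /andP[uS du]]|none] := boolP [exists u, (u \in S) && (out O u < d)].
  move: uS; rewrite inE => /connectP[p0 pp0 uE].
  move: uE; case: (shortenP pp0) => p pp up _ uE.
  have [O' [oO' outE _]] := reverse_path oO pp up.
  have uv : u != v by apply: contraTneq du => ->; rewrite -leqNgt ltnW.
  have := minO O' (introT (orientedP _) oO'); rewrite leqNgt => /negP[].
  rewrite /excess (bigD1 v) //= [ltnRHS](bigD1 v) //= -addSn; apply: leq_add.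
    by have := outE v; rewrite eqxx -uE [v == u]eq_sym (negPf uv); lia.
  apply: leq_sum => x xv; have := outE x; rewrite (negPf xv) -uE.
  by have [->|] := eqVneq x u; lia.
have allS u : u \in S -> d <= out O u.
  by move=> uS; rewrite leqNgt; apply: contra none => ltu; apply/existsP; exists u; rewrite uS.
(* [S] is closed under out-neighbours, so the arcs leaving its vertices are edges inside [S]. *)
pose A := [set p in O | p.1 \in S].
have cardA : d * #|S| < #|A|.
  have -> : #|A| = \sum_(u in S) out O u.
    rewrite -sum1_card (partition_big fst (mem S)) /=; last first.
      by move=> p; rewrite inE => /andP[].
    apply: eq_bigr => u uS; have inj : injective (@pair H H u) by move=> y z [].
    rewrite sum1dep_card /out -(card_imset _ inj).
    apply: eq_card => -[x y]; rewrite !inE /=; apply/andP/imsetP => [[/andP[xy _] /eqP <-]|[z zO [-> ->]]].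
      by exists y; rewrite ?inE.
    by move: zO uS; rewrite !inE => -> ->; rewrite eqxx.
  rewrite mulnC -sum_nat_const (bigD1 v) //= [ltnRHS](bigD1 v) //= -addSn.
  by apply: leq_add => //; apply: leq_sum => u /andP[uS _]; exact: allS.
pose e (p : H * H) := [set p.1; p.2].
have e_inj : {in A &, injective e}.
  move=> [x y] [x' y']; rewrite !inE /= => /andP[xy _] /andP[xy' _] eqe.
  have xyne : x != y by apply: contraTneq xy => ->; apply/negP => xx; have := orients_asym oO xx; rewrite xx.
  have : x' \in e (x, y) by rewrite eqe !inE eqxx.
  have : y' \in e (x, y) by rewrite eqe !inE eqxx orbT.
  have xyne' : x' != y' by apply: contraTneq xy' => ->; apply/negP => xx; have := orients_asym oO xx; rewrite xx.
  rewrite !inE /= => /orP[] /eqP ey /orP[] /eqP ex; move: xyne' xy'; rewrite ex ey ?eqxx // => _.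
  by move=> yx; have := orients_asym oO xy; rewrite yx.
have sg : is_subgraph (S, e @: A) && (S != set0).
  apply/andP; split; last by apply/set0Pn; exists v.
  apply/andP; split=> /=.
    apply/subsetP => _ /imsetP[p pA ->].
    have pO : p \in O by move: pA; rewrite inE => /andP[].
    apply/imsetP; exists p => //; rewrite inE.
    by have [+ _] := oO p.1 p.2; rewrite -surjective_pairing; apply.
  apply/forall_inP => _ /imsetP[[x y] xyA ->].
  have [xy xS] : (x, y) \in O /\ x \in S by apply/andP; move: xyA; rewrite inE.
  apply/subsetP => z; rewrite !inE /= => /orP[] /eqP ->; first by move: xS; rewrite inE.
  by move: xS; rewrite inE => xS; apply: connect_trans xS (connect1 xy).
have := le_trans (le_bigmax_cond 0%R (fun S : {set H} * {set {set H}} => #|S.2|%:R / #|S.1|%:R : rat)%R sg) dens.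
rewrite /= card_in_imset // ler_pdivrMr; last by rewrite ltr0n card_gt0; apply/set0Pn; exists v.
by rewrite -natrM ler_nat leqNgt cardA.
Qed.

Lemma functional_decomposition (d D : nat) :
  (density H <= d%:R)%R -> max_degree H <= D ->
  exists f : 'I_d -> H -> H,
    (forall i v, #|f i @^-1: [set v]| <= D.+1) /\
    (forall x y, adj x y -> exists i, y = f i x \/ x = f i y).
Proof.
move=> /bounded_orientation[O [oO outO]] degH.
(* The default [x] turns a missing out-neighbour into a fixed point. A fibre over [v] may thus
   contain [v] besides its neighbours, whence [D.+1]. *)
pose f (i : 'I_d) x := nth x (enum [set y | (x, y) \in O]) i.
have f_adj i x : f i x != x -> adj (f i x) x.
  move=> ne; have := mem_nth x (s := enum [set y | (x, y) \in O]) (n := i).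
  have [lt|ge] := ltnP i (size (enum [set y | (x, y) \in O])); last first.
    by move: ne; rewrite /f nth_default ?eqxx.
  move=> /(_ isT); rewrite mem_enum inE => xf.
  by rewrite adj_sym; have [+ _] := oO x (f i x); apply.
exists f; split=> [i v|].
  apply: (@leq_trans #|v |: [set y | adj v y]|).
    apply/subset_leq_card/subsetP => x; rewrite !inE => /eqP e.
    by have [->//|xv] := eqVneq x v; rewrite -e f_adj // e eq_sym.
  apply: leq_trans (leq_card_setU _ _) _; rewrite cards1 add1n ltnS.
  by apply: leq_trans degH; exact: (leq_bigmax (F := fun x => #|[set y | adj x y]|)).
have arcP x y : (x, y) \in O -> exists i, y = f i x.
  move=> xy; have yin : y \in enum [set y | (x, y) \in O] by rewrite mem_enum inE.
  have lt : index y (enum [set y | (x, y) \in O]) < d.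
    by apply: leq_trans (outO x); rewrite /out cardE index_mem.
  by exists (Ordinal lt); rewrite /f /= nth_index.
move=> x y xy; have [_ /(_ xy)] := oO x y.
have [xyO _|_ yxO] := boolP ((x, y) \in O).
  by have [i e] := arcP _ _ xyO; exists i; left.
by have [i e] := arcP _ _ yxO; exists i; right.
Qed.

End Orientation.

(** * Cutting functional graphs into small pieces *)

Section RootedForest.

Variables (V : finType) (f : V -> V) (depth : V -> nat).
(* The vertices of depth 0 are the roots of a spanning forest; the edge from a
   root [v] to [f v] closes the cycle of its component. *)
Hypothesis dep_step : forall v, 0 < depth v -> depth (f v) = (depth v).-1.
Hypothesis dep_root : forall v, depth v = 0 -> iter (depth (f v)) f (f v) = v.

Definition root_of v := iter (depth v) f v.
Definition subtree v := [set w | (depth v <= depth w) && (iter (depth w - depth v) f w == v)].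
Definition children v := [set c | (0 < depth c) && (f c == v)].

Lemma dep_iter j w : j <= depth w -> depth (iter j f w) = depth w - j.
Proof. by elim: j => [|j IH] lej /=; rewrite ?subn0 // dep_step IH; lia. Qed.

Lemma dep_ch c v : c \in children v -> depth c = (depth v).+1.
Proof. by rewrite inE => /andP[c0 /eqP<-]; rewrite dep_step // prednK. Qed.

Lemma rt_f v : root_of (f v) = root_of v.
Proof.
rewrite /root_of; have [d0|d0] := posnP (depth v); first by rewrite dep_root // d0.
by rewrite dep_step // -iterSr prednK.
Qed.

Lemma rt_root v : depth v = 0 -> root_of v = v.
Proof. by rewrite /root_of => ->. Qed.

Lemma dep_rt v : depth (root_of v) = 0.
Proof. by rewrite dep_iter // subnn. Qed.

Lemma sub_refl v : v \in subtree v.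
Proof. by rewrite inE leqnn subnn /=. Qed.

Lemma sub_rtP w : w \in subtree (root_of w).
Proof. by rewrite inE dep_rt subn0 /= /root_of. Qed.

Lemma rt_sub v w : w \in subtree v -> root_of w = root_of v.
Proof.
rewrite inE => /andP[le_vw /eqP wv].
by rewrite /root_of -{2}wv -iterD subnKC.
Qed.

Lemma sub_ch c v w : c \in children v -> w \in subtree c -> w \in subtree v.
Proof.
move=> cv; have dc := dep_ch cv; move: cv; rewrite !inE => /andP[_ /eqP<-].
rewrite dep_step ?dc //= => /andP[lecw /eqP wc].
have -> : depth w - depth v = (depth w - (depth v).+1).+1 by lia.
by rewrite iterS wc eqxx andbT ltnW.
Qed.

Lemma sub_up v w : 0 < depth v -> w \in subtree v -> w \in subtree (f v).
Proof. by move=> v0; apply: sub_ch; rewrite inE v0 /=. Qed.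

(** A child of [v] whose subtree contains [w] is the iterate of [f] at [w] of depth one more than
    [v]; hence it is unique, and there is none for [w = v]. *)
Lemma sub_ch_indicator w v :
  \sum_(c in children v) (w \in subtree c) + (w == v) <= (w \in subtree v).
Proof.
have [->|wv] := eqVneq w v.
  rewrite big1 ?sub_refl // => c cv; apply/eqP; rewrite eqb0 inE.
  by rewrite (dep_ch cv) ltnn.
rewrite addn0.
case: (pickP [pred c | (c \in children v) && (w \in subtree c)]) => [c0 /andP[cv wc]|no].
  rewrite (bigD1 c0) //= big1 ?wc ?(sub_ch cv wc) // => c /andP[c'v ne].
  apply/eqP; rewrite eqb0; apply: contra ne => wc'.
  move: wc wc'; rewrite !inE (dep_ch cv) (dep_ch c'v).
  by move=> /andP[_ /eqP<-] /andP[_ /eqP<-].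
rewrite big1 // => c cv; apply/eqP; rewrite eqb0.
by have := no c; rewrite /= cv /= => ->.
Qed.

Lemma card_sub_ch v : \sum_(c in children v) #|subtree c| < #|subtree v|.
Proof.
have sumE u : #|subtree u| = \sum_w (w \in subtree u) by rewrite -sum1_card big_mkcond.
rewrite sumE; under eq_bigr do rewrite sumE.
rewrite exchange_big /= -addn1.
have -> : 1 = \sum_w (w == v) by rewrite (bigD1 v) //= eqxx big1 // => w /negPf->.
by rewrite -big_split /= leq_sum // => w _; exact: sub_ch_indicator.
Qed.

Lemma leq_card_sub c v : c \in subtree v -> #|subtree c| <= #|subtree v|.
Proof.
rewrite inE => /andP[le_vc /eqP].
move: {2}(depth c - depth v) (erefl (depth c - depth v)) => k ek.
elim: k c ek le_vc => [|k IH] c ek le_vc; first by rewrite ek /= => ->.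
rewrite ek iterSr => fk; have c0 : 0 < depth c by lia.
apply: (@leq_trans #|subtree (f c)|).
  by apply/subset_leq_card/subsetP => w; exact: sub_up.
have df := dep_step c0; apply: IH; [lia | lia |].
by rewrite -[RHS]fk; congr iter; lia.
Qed.

Lemma forest_sum (phi : V -> nat) :
  \sum_v phi v = \sum_(v | depth v == 0) phi v + \sum_v \sum_(c in children v) phi c.
Proof.
rewrite (bigID (fun v => depth v == 0)) /=; congr (_ + _).
rewrite (partition_big f predT) //=; apply: eq_bigr => v _.
by apply: eq_bigl => c; rewrite inE lt0n.
Qed.

Lemma sum_root_sub : \sum_(v | depth v == 0) #|subtree v| <= #|V|.
Proof.
rewrite -[X in _ <= X]sum1_card [X in _ <= X](partition_big root_of (fun v => depth v == 0)) /=.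
  apply: leq_sum => v v0; rewrite -sum1_card; apply: eq_leq; apply: eq_bigl => w.
  apply/idP/eqP => [/rt_sub->|<-]; last exact: sub_rtP.
  by rewrite rt_root ?(eqP v0).
by move=> v _; rewrite dep_rt.
Qed.

(** * Components of the forest after deleting a vertex set *)

Section Pieces.

Variable Y : {set V}.

(** With fuel [depth v] the walk stops at the root at the latest and never takes the edge closing
    the cycle. Its end names the component of [v] outside [Y]. *)
Fixpoint climb n v :=
  if n is n'.+1 then if f v \in Y then v else climb n' (f v) else v.
Definition top v := climb (depth v) v.
Definition piece t := [set v | (v \notin Y) && (top v == t)].

Lemma top_step v : 0 < depth v -> f v \notin Y -> top v = top (f v).
Proof.
by move=> v0 fY; rewrite /top dep_step //; case: (depth v) v0 => //= n _; rewrite (negPf fY).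
Qed.

Lemma top_stop v : (depth v == 0) || (f v \in Y) -> top v = v.
Proof. by rewrite /top; case: (depth v) => //= n ->. Qed.

Lemma topP v : v \notin Y -> [/\ top v \notin Y,
  (depth (top v) == 0) || (f (top v) \in Y) & v \in subtree (top v)].
Proof.
have [n] := ubnP (depth v); elim: n v => // n IH v; rewrite ltnS => len vY.
have [stop|] := boolP ((depth v == 0) || (f v \in Y)).
  by rewrite top_stop // sub_refl.
rewrite negb_or -lt0n => /andP[v0 fY]; rewrite top_step //.
have [|//|tY st vsub] := IH (f v); first by rewrite dep_step //; lia.
split=> //; move: vsub; rewrite !inE dep_step // => /andP[le1 /eqP e1].
apply/andP; split; first by lia.
by rewrite -[X in _ == X]e1 -iterSr; apply/eqP; congr iter; lia.
Qed.

Lemma top_top v : v \notin Y -> top (top v) = top v.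
Proof. by move=> /topP[_ st _]; rewrite top_stop. Qed.

Lemma mem_piece_top v t : v \in piece t -> t \in piece t.
Proof.
by rewrite !inE => /andP[vY /eqP<-]; rewrite top_top // eqxx; case: (topP vY) => ->.
Qed.

Lemma piece_up t c : t \in piece t ->
  ((c \in piece t) && (c != t)) = [&& 0 < depth c, c \notin Y & f c \in piece t].
Proof.
move=> tP; apply/idP/idP => [/andP[]|/and3P[c0 cY]].
  rewrite !inE => /andP[cY /eqP ct] ne.
  have [stop|] := boolP ((depth c == 0) || (f c \in Y)).
    by move: ne; rewrite -ct top_stop // eqxx.
  rewrite negb_or -lt0n => /andP[c0 fY]; rewrite c0 cY fY /=.
  by rewrite -top_step // ct.
rewrite !inE cY => /andP[fY /eqP ft]; rewrite top_step // ft eqxx /=.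
apply/eqP => ct; have [_ ] := topP fY; rewrite ft -ct => + _.
by rewrite (negPf fY) orbF; lia.
Qed.

Lemma piece_sum (phi : V -> nat) t : t \in piece t ->
  \sum_(v in piece t) phi v =
    phi t + \sum_(v in piece t) \sum_(c in children v | c \notin Y) phi c.
Proof.
move=> tP; rewrite (bigD1 t) //=; congr (_ + _).
rewrite (partition_big f (mem (piece t))) /=; last first.
  by move=> c; rewrite piece_up // => /and3P[].
apply: eq_bigr => v vP; apply: eq_bigl => c; rewrite piece_up //.
have -> : (c \in children v) = (0 < depth c) && (f c == v) by rewrite inE.
by case: (f c =P v) => [->|]; rewrite ?andbF //= vP !andbT.
Qed.

(** Telescoping: every vertex of the piece except [t] is a child of exactly one other, so the inner
    potentials cancel and only [t] and the children in [Y] below the piece remain. *)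
Lemma piece_loss (phi loss : V -> nat) t : t \in piece t ->
  (forall v, v \in piece t -> \sum_(c in children v) phi c + loss v <= phi v) ->
  \sum_(v in piece t) loss v +
    \sum_(v in piece t) \sum_(c in children v | c \in Y) phi c <= phi t.
Proof.
move=> tP le_phi; have eq1 := piece_sum phi tP.
have : \sum_(v in piece t) (\sum_(c in children v) phi c + loss v) <=
   \sum_(v in piece t) phi v by exact: leq_sum.
rewrite big_split /=.
have -> : \sum_(v in piece t) \sum_(c in children v) phi c =
    \sum_(v in piece t) \sum_(c in children v | c \in Y) phi c +
    \sum_(v in piece t) \sum_(c in children v | c \notin Y) phi c.
  by rewrite -big_split /=; apply: eq_bigr => v _; rewrite (bigID (mem Y)).
by lia.
Qed.

Lemma piece_gain (phi : V -> nat) t : t \in piece t ->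
  (forall v, v \in piece t -> phi v <= \sum_(c in children v) phi c) ->
  phi t <= \sum_(v in piece t) \sum_(c in children v | c \in Y) phi c.
Proof.
move=> tP le_phi; have eq1 := piece_sum phi tP.
have : \sum_(v in piece t) phi v <= \sum_(v in piece t) \sum_(c in children v) phi c
  by exact: leq_sum.
have -> : \sum_(v in piece t) \sum_(c in children v) phi c =
    \sum_(v in piece t) \sum_(c in children v | c \in Y) phi c +
    \sum_(v in piece t) \sum_(c in children v | c \notin Y) phi c.
  by rewrite -big_split /=; apply: eq_bigr => v _; rewrite (bigID (mem Y)).
by lia.
Qed.

End Pieces.

(** * Separators at the scales [s ^ j] and their thickenings *)

Section Separators.

Variables (Delta s H : nat).
Hypothesis fibre_f : forall v, #|f @^-1: [set v]| <= Delta.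
Hypothesis s_large : 2 * (Delta + 2) <= s.

Let s_gt0 : 0 < s. Proof. by lia. Qed.
Let sX_gt0 j : 0 < s ^ j. Proof. by rewrite expn_gt0 s_gt0. Qed.

(** Rounding down makes subtrees with fewer than [s ^ j] vertices weightless; those of positive mass
    are the heavy ones. *)
Definition mass j v := #|subtree v| %/ s ^ j.
(* The first two conditions ensure that a component avoiding [sep j] has O(s^j)
   vertices and that at most one of the subtrees hanging below it is heavy. *)
Definition sep j := [set v |
  [|| 1 < \sum_(c in children v) (0 < mass j c),
      \sum_(c in children v) mass j c < mass j v
    | (depth v == 0) && (0 < mass j v)]].

Lemma mass_ch j v : \sum_(c in children v) mass j c <= mass j v.
Proof.
rewrite leq_divRL // big_distrl /=.
apply: leq_trans (ltnW (card_sub_ch v)).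
by apply: leq_sum => c _; exact: leq_trunc_div.
Qed.

Lemma mass_ch1 j v c : c \in children v -> mass j c <= mass j v.
Proof.
by move=> cv; apply: leq_trans (mass_ch j v); rewrite (bigD1 c) //= leq_addr.
Qed.

Lemma sep_mass j v : v \in sep j -> 0 < mass j v.
Proof.
rewrite inE => /or3P[two|lt|/andP[] //]; last by lia.
have : \sum_(c in children v) (0 < mass j c) <= \sum_(c in children v) mass j c.
  by apply: leq_sum => c _; case: (mass j c).
by have := mass_ch j v; lia.
Qed.

(* The potential 2 mass - 1 decreases strictly at every separator vertex. *)
Lemma potential_step j v :
  \sum_(c in children v) (2 * mass j c).-1 + ((v \in sep j) && (0 < depth v)) <=
    (2 * mass j v).-1.
Proof.
have le := mass_ch j v.
have e : \sum_(c in children v) (2 * mass j c).-1 + \sum_(c in children v) (0 < mass j c) =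
    2 * \sum_(c in children v) mass j c.
  by rewrite -big_split big_distrr /=; apply: eq_bigr => c _; lia.
have le2 : \sum_(c in children v) (0 < mass j c) <= \sum_(c in children v) mass j c.
  by apply: leq_sum => c _; case: (mass j c).
have [vs|] := boolP (v \in sep j); last first.
  move=> _; rewrite addn0.
  have [z|z] := posnP (\sum_(c in children v) (0 < mass j c)); last by lia.
  suff : \sum_(c in children v) mass j c = 0 by lia.
  apply: big1 => c cv; move/eqP: z; rewrite sum_nat_eq0 => /forall_inP/(_ c cv).
  by case: (mass j c).
have m0 := sep_mass vs; move: vs; rewrite inE => /or3P[two|lt|/andP[/eqP-> _]].
- by case: (0 < depth v); rewrite /=; lia.
- by case: (0 < depth v); rewrite /=; lia.
have [z|z] := posnP (\sum_(c in children v) (0 < mass j c)); last by rewrite ltnn /=; lia.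
suff : \sum_(c in children v) mass j c = 0 by rewrite ltnn /=; lia.
apply: big1 => c cv; move/eqP: z; rewrite sum_nat_eq0 => /forall_inP/(_ c cv).
by case: (mass j c).
Qed.

(** Summed over the forest, the potential drops bound the separator vertices other than roots by the
    potentials of the roots. A separator root is paid for by the 1 subtracted in its own
    potential. *)
Lemma card_sep j : #|sep j| * s ^ j <= 2 * #|V|.
Proof.
suff : #|sep j| <= \sum_(v | depth v == 0) 2 * mass j v.
  move=> le; apply: (@leq_trans ((\sum_(v | depth v == 0) 2 * mass j v) * s ^ j)).
    by rewrite leq_mul2r le orbT.
  rewrite big_distrl /=; apply: leq_trans (leq_mul (leqnn 2) sum_root_sub).
  rewrite big_distrr /=; apply: leq_sum => v _.
  by rewrite -mulnA leq_mul2l leq_trunc_div.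
have eq1 := forest_sum (fun v => (2 * mass j v).-1).
have : \sum_v (\sum_(c in children v) (2 * mass j c).-1 +
    ((v \in sep j) && (0 < depth v))) <= \sum_v (2 * mass j v).-1.
  by apply: leq_sum => v _; exact: potential_step.
rewrite big_split /=.
have -> : #|sep j| = \sum_v ((v \in sep j) && (0 < depth v)) +
    \sum_(v | depth v == 0) (v \in sep j).
  rewrite -sum1_card big_mkcond [X in _ + X]big_mkcond -big_split /=.
  by apply: eq_bigr => v _; case: (v \in sep j); case: (depth v).
have : \sum_(v | depth v == 0) (2 * mass j v).-1 +
    \sum_(v | depth v == 0) (v \in sep j) <= \sum_(v | depth v == 0) 2 * mass j v.
  rewrite -big_split /=; apply: leq_sum => v v0.
  by case: (boolP (v \in sep j)) => [/sep_mass|_] /=; lia.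
by lia.
Qed.

Definition nbhd (A : {set V}) := A :|: f @: A :|: f @^-1: A.

Lemma card_nbhd A : #|nbhd A| <= (Delta + 2) * #|A|.
Proof.
apply: (@leq_trans (#|A| + #|f @: A| + #|f @^-1: A|)).
  by apply: leq_trans (leq_card_setU _ _) _; rewrite leq_add2r leq_card_setU.
have : #|f @^-1: A| <= Delta * #|A|.
  rewrite -sum1_card (partition_big f (mem A)) /=; last by move=> v; rewrite inE.
  rewrite mulnC -sum_nat_const; apply: leq_sum => v vA.
  apply: leq_trans (fibre_f v); rewrite -sum1_card; apply: eq_leq; apply: eq_bigl => w.
  by rewrite !inE; case: eqP => [->|]; rewrite ?vA ?andbF.
by have := leq_imset_card f A; rewrite mulnDl; lia.
Qed.

Lemma sub_nbhd (A : {set V}) : A \subset nbhd A.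
Proof. by rewrite /nbhd -setUA subsetUl. Qed.

Lemma nbhd_f (A : {set V}) v : f v \in A -> v \in nbhd A.
Proof. by move=> h; rewrite !inE h orbT. Qed.

Lemma f_nbhd (A : {set V}) v : v \in A -> f v \in nbhd A.
Proof. by move=> h; rewrite !inE imset_f ?orbT. Qed.

(* [fat k] thickens [fat k.+1] by one neighbourhood, so that the heights defined
   from these sets differ by at most 1 along [f]. *)
Fixpoint fatr i :=
  if i is i'.+1 then sep (H - i) :|: nbhd (fatr i') else sep H.
Definition fat k := fatr (H - k).

Lemma fat_top : fat H = sep H.
Proof. by rewrite /fat subnn. Qed.

Lemma fatE k : k < H -> fat k = sep k :|: nbhd (fat k.+1).
Proof.
move=> lt; rewrite /fat; have -> : H - k = (H - k.+1).+1 by lia.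
by rewrite /=; congr (sep _ :|: _); lia.
Qed.

Lemma fat_ind (P : nat -> Prop) : P H ->
  (forall k, k < H -> P k.+1 -> P k) -> forall k, k <= H -> P k.
Proof.
move=> PH PS k; move: {2}(H - k) (erefl (H - k)) => i.
elim: i k => [|i IH] k ek lek; first by have -> : k = H by lia.
by apply: PS; [lia | apply: IH; lia].
Qed.

Lemma sep_fat k : k <= H -> sep k \subset fat k.
Proof.
rewrite leq_eqVlt => /orP[/eqP->|lt]; first by rewrite fat_top.
by rewrite fatE // subsetUl.
Qed.

Lemma fat_mono j k : j <= k -> k <= H -> fat k \subset fat j.
Proof.
move=> jk kH; have jH := leq_trans jk kH.
elim/fat_ind: j / jH jk => [|j lt IH] jk; first by have -> : k = H by lia.
move: jk; rewrite leq_eqVlt => /orP[/eqP->//|jk].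
by apply: subset_trans (IH jk) _; rewrite (fatE lt) subsetU // sub_nbhd orbT.
Qed.

(** Half of the 4 pays for [sep k]. Thickening [fat k.+1] multiplies its size by at most
    [Delta + 2], but its bound is better by a factor [s >= 2 * (Delta + 2)], so it costs the other
    half. *)
Lemma card_fat k : k <= H -> #|fat k| * s ^ k <= 4 * #|V|.
Proof.
move=> kH; elim/fat_ind: k / kH => [|k lt IH].
  by rewrite fat_top; apply: leq_trans (card_sep H) _; lia.
have h1 := card_sep k.
have h2 : #|fat k| <= #|sep k| + (Delta + 2) * #|fat k.+1|.
  by rewrite fatE //; apply: leq_trans (leq_card_setU _ _) _; rewrite leq_add2l card_nbhd.
have h3 : 2 * ((Delta + 2) * #|fat k.+1| * s ^ k) <= #|fat k.+1| * s ^ k.+1.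
  rewrite expnS; have : 2 * (Delta + 2) * (#|fat k.+1| * s ^ k) <=
    s * (#|fat k.+1| * s ^ k) by rewrite leq_mul2r s_large orbT.
  by lia.
have h4 : #|fat k| * s ^ k <= (#|sep k| + (Delta + 2) * #|fat k.+1|) * s ^ k.
  by rewrite leq_mul2r h2 orbT.
by move: h4; rewrite mulnDl; lia.
Qed.

(** Thickening along [f] never leaves a component, so a component whose root is weightless stays
    free of [fat k]. *)
Lemma fat_mass_root k v : k <= H -> v \in fat k -> 0 < mass k (root_of v).
Proof.
move=> kH; elim/fat_ind: k / kH v => [v|k lt IH v].
  rewrite fat_top => /sep_mass vm; apply: leq_trans vm _.
  by apply: leq_div2r; apply: leq_card_sub; exact: sub_rtP.
rewrite fatE // inE => /orP[/sep_mass vm|vN].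
  by apply: leq_trans vm _; apply: leq_div2r; apply: leq_card_sub; exact: sub_rtP.
suff : 0 < mass k.+1 (root_of v).
  move=> m; apply: leq_trans m _; apply: leq_div2l => //.
  by rewrite leq_pexp2l.
move: vN; rewrite !inE -orbA => /or3P[/IH//|/imsetP[u /IH um ->]|/IH].
  by rewrite rt_f.
by rewrite rt_f.
Qed.

(* A vertex of the thickened separator whose parent lies outside of it was
   reached from below, or through the edge closing the cycle. *)
Lemma fat_entry k c : k <= H -> c \in fat k -> 0 < depth c -> f c \notin fat k ->
  (0 < mass k c) || (f (root_of c) \in subtree c).
Proof.
move=> kH; elim/fat_ind: k / kH c => [c|k lt IH c].
  by rewrite fat_top => /sep_mass->.
have mono : fat k.+1 \subset fat k by apply: fat_mono.
have massS u : 0 < mass k.+1 u -> 0 < mass k u.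
  by move=> m; apply: leq_trans m _; apply: leq_div2l => //; rewrite leq_pexp2l.
move=> cf c0 fc; have fc' : f c \notin fat k.+1 by apply: contra fc; apply: subsetP.
move: cf; rewrite fatE // inE => /orP[/sep_mass->//|cN].
have [c1|c1] := boolP (c \in fat k.+1).
  by case/orP: (IH c c1 c0 fc') => [/massS->//|->]; rewrite orbT.
move: cN; rewrite !in_setU (negPf c1) /= => /orP[/imsetP[u u1 cu]|]; last first.
  by rewrite inE (negPf fc').
have [u0|u0] := posnP (depth u).
  have -> : f (root_of c) = c by rewrite cu rt_f rt_root.
  by rewrite sub_refl orbT.
have uch : u \in children c by rewrite inE u0 cu eqxx.
have := IH u u1 u0; rewrite -cu => /(_ c1)/orP[/massS m|h].
  by rewrite (leq_trans m (mass_ch1 _ uch)).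
have -> : root_of c = root_of u by rewrite cu rt_f.
by rewrite (sub_ch uch h) orbT.
Qed.

(** Only the edge closing a cycle needs care. Its root end avoids [sep k], hence is weightless, so
    the whole component avoids [fat k] and is a single piece. *)
Lemma fat_top_edge k x : k <= H -> x \notin fat k -> f x \notin fat k ->
  top (fat k) x = top (fat k) (f x).
Proof.
move=> kH xY fxY; have [x0|x0] := posnP (depth x); last exact: top_step.
have m0 : mass k x = 0.
  apply/eqP; rewrite -leqn0 leqNgt; apply: contra xY => m.
  by apply: (subsetP (sep_fat kH)); rewrite inE x0 m !orbT.
have clear u : root_of u = x -> u \notin fat k.
  by move=> rx; apply/negP => /(fat_mass_root kH); rewrite rx m0.
have root_top u : root_of u = x -> top (fat k) u = x.
  move=> rx; have [tY st us] := topP (clear _ rx).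
  have rtt : root_of (top (fat k) u) = x by rewrite -(rt_sub us).
  case/orP: st => [/eqP d0|]; first by rewrite -(rt_root d0).
  by have /negPf-> : f (top (fat k) u) \notin fat k by apply: clear; rewrite rt_f.
have rx := rt_root x0.
by rewrite (root_top x) // (root_top (f x)) // rt_f.
Qed.

(** * Bounds inside a single piece *)

Section PieceBounds.

Variables (l : nat) (t : V).
Hypothesis lH : l < H.
Let Y := fat l.+1.
Let P := piece Y t.
Hypothesis tP : t \in P.

Let notY v : v \in P -> v \notin Y.
Proof. by rewrite inE => /andP[]. Qed.

Let notsep v : v \in P -> v \notin sep l.+1.
Proof. by move=> /notY; apply: contra; apply/subsetP/sep_fat. Qed.

(** Being heavy serves as a potential: outside [sep l.+1] a vertex has at most one heavy child, and
    is then heavy itself. *)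
Lemma heavy_boundary :
  \sum_(v in P) \sum_(c in children v | c \in Y) (0 < mass l.+1 c) <= 1.
Proof.
have := @piece_loss Y (fun v => 0 < mass l.+1 v : nat) (fun=> 0) t tP.
rewrite big1_eq add0n => h; apply: leq_trans (h _) (leq_b1 _) => v vP.
rewrite addn0; have := notsep vP; rewrite inE !negb_or -!leqNgt => /and3P[le1 _ _].
have [z|z] := posnP (\sum_(c in children v) (0 < mass l.+1 c)); first by rewrite z.
have : 0 < mass l.+1 v.
  apply: leq_trans z (leq_trans _ (mass_ch _ _)).
  by apply: leq_sum => c _; case: (mass _ _).
by move=> ->.
Qed.

Lemma closing_boundary x :
  \sum_(v in P) \sum_(c in children v | c \in Y) (x \in subtree c) <= 1.
Proof.
have := @piece_loss Y (fun v => x \in subtree v : nat) (fun=> 0) t tP.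
rewrite big1_eq add0n => h; apply: leq_trans (h _) (leq_b1 _) => v _.
by rewrite addn0; apply: leq_trans (sub_ch_indicator x v); rewrite leq_addr.
Qed.

Lemma piece_sub v : v \in P -> v \in subtree t.
Proof. by rewrite inE => /andP[vY /eqP<-]; case: (topP vY). Qed.

Lemma piece_dep0 v : v \in P -> depth v = 0 -> v = t.
Proof.
move=> vP v0; have := piece_sub vP; rewrite inE v0 leqn0 => /andP[/eqP->].
by move=> /eqP.
Qed.

Lemma piece_rt v : v \in P -> root_of v = root_of t.
Proof. by move=> /piece_sub /rt_sub. Qed.

Definition entries := [set v in P | v \in nbhd Y].

(** The piece meets [Y] through the edge above [t], through the end [f (root_of t)] of the closing
    edge, or through a child in [Y]. By [fat_entry] such a child is heavy or has that end below it,
    and each case occurs at most once. *)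
Lemma card_entries : #|entries| <= 4.
Proof.
pose below := [set v in P | 0 < #|[set c in children v | c \in Y]|].
have sub_e : entries \subset [set t; f (root_of t)] :|: below.
  apply/subsetP => v; rewrite inE => /andP[vP vN]; apply/setUP.
  move: vN; rewrite !in_setU (negPf (notY vP)) /= => /orP[/imsetP[u uY vu]|].
    have [u0|u0] := posnP (depth u).
      left; have -> : f (root_of t) = v by rewrite -(piece_rt vP) vu rt_f rt_root.
      by rewrite !inE eqxx orbT.
    right; rewrite in_set vP; apply/card_gt0P.
    by exists u; rewrite !inE u0 vu eqxx.
  rewrite inE => fY; left; suff -> : v = t by rewrite !inE eqxx.
  have [v0|v0] := posnP (depth v); first exact: piece_dep0.
  apply/eqP; apply: contraLR fY => ne.
  have := piece_up v tP; rewrite vP ne /= => /esym/and3P[_ _ fP].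
  by rewrite inE (notY fP).
apply: leq_trans (subset_leq_card sub_e) _.
apply: leq_trans (leq_card_setU _ _) _.
have c2 : #|[set t; f (root_of t)]| <= 2 by rewrite cards2; case: (t != _).
suff : #|below| <= 2 by lia.
apply: (@leq_trans (\sum_(v in P) \sum_(c in children v | c \in Y)
    ((0 < mass l.+1 c) + (f (root_of t) \in subtree c)))); last first.
  under eq_bigr do rewrite big_split /=.
  rewrite big_split /=; have := heavy_boundary; have := closing_boundary (f (root_of t)).
  by lia.
have -> : #|below| = \sum_(v in P) (0 < #|[set c in children v | c \in Y]|).
  rewrite -sum1_card big_mkcond [RHS]big_mkcond /=; apply: eq_bigr => v _.
  by rewrite inE; case: (v \in P) => //=; case: (0 < _).
apply: leq_sum => v vP; have [//|c0] := posnP #|[set c in children v | c \in Y]|.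
have /card_gt0P[c] := c0; rewrite inE => /andP[cv cY].
rewrite (bigD1 c) ?cv //=; apply: leq_trans (leq_addr _ _).
have dc := dep_ch cv; have fc : f c = v by move: cv; rewrite inE => /andP[_ /eqP].
have := @fat_entry l.+1 c lH cY; rewrite fc dc => /(_ isT (notY vP)).
have -> : root_of c = root_of t by rewrite -rt_f fc piece_rt.
by rewrite /mass; lia.
Qed.

(** Each separator vertex costs one unit of the potential at scale [j]. No mass at scale [l.+1] is
    lost inside the piece, so the potential at [t] exceeds that of the boundary only by the rounding
    between the two scales. *)
Lemma card_piece_sep j : j <= l -> #|P :&: sep j| <= 4 * s ^ (l.+1 - j).
Proof.
move=> jl; set i := l.+1 - j.
have eji : s ^ l.+1 = s ^ j * s ^ i by rewrite -expnD; congr expn; rewrite /i; lia.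
have massM u : mass l.+1 u = mass j u %/ s ^ i by rewrite /mass eji divnMA.
have le1 := @piece_loss Y (fun v => (2 * mass j v).-1)
   (fun v => (v \in sep j) && (0 < depth v) : nat) t tP (fun v _ => potential_step j v).
have le2 : mass l.+1 t <= \sum_(v in P) \sum_(c in children v | c \in Y) mass l.+1 c.
  apply: piece_gain => // v vP; have := notsep vP.
  by rewrite inE !negb_or -!leqNgt => /and3P[].
(* Only heavy boundary children count on the left, and there is at most one, so the 1 subtracted in
   the potential is lost once. *)
have le3 : 2 * s ^ i * \sum_(v in P) \sum_(c in children v | c \in Y) mass l.+1 c <=
    \sum_(v in P) \sum_(c in children v | c \in Y) (2 * mass j c).-1 + 1.
  apply: leq_trans (leq_add (leqnn _) heavy_boundary).
  rewrite -big_split big_distrr /=; apply: leq_sum => v _.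
  rewrite -big_split big_distrr /=; apply: leq_sum => c _.
  have h := leq_trunc_div (mass j c) (s ^ i); rewrite -massM in h.
  have [->|m0] := posnP (mass l.+1 c); first by rewrite muln0.
  by rewrite /=; lia.
have le4 : mass j t < (mass l.+1 t).+1 * s ^ i by rewrite massM ltn_ceil.
have le5 : 2 * s ^ i * mass l.+1 t <=
    2 * s ^ i * \sum_(v in P) \sum_(c in children v | c \in Y) mass l.+1 c.
  by rewrite leq_mul2l le2 orbT.
(* The potential does not register separator vertices that are roots, but [t] is the only possible
   root in the piece. *)
have le6 : #|P :&: sep j| <=
    \sum_(v in P) ((v \in sep j) && (0 < depth v)) + 1.
  have -> : #|P :&: sep j| = \sum_(v in P) (v \in sep j).
    rewrite -sum1_card big_mkcond [RHS]big_mkcond; apply: eq_bigr => v _.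
    by rewrite inE; case: (v \in P); case: (v \in sep j).
  rewrite (bigD1 t) //= [X in _ <= X + 1](bigD1 t) //=.
  rewrite addnC; apply: leq_add; last exact: leq_b1.
  apply: leq_trans (leq_addl _ _); apply: leq_sum => v /andP[vP ne].
  have [v0|v0] := posnP (depth v); last by rewrite andbT.
  by rewrite (piece_dep0 vP v0) eqxx in ne.
have : 0 < s ^ i := sX_gt0 i.
rewrite -/Y -/P in le1.
by move: le1 le3 le4 le5 le6; rewrite mulSn; lia.
Qed.

(** Downward induction from [j = l.+1], where the intersection is empty. With [i = l.+1 - j], the
    three sources are separators ([4 * s ^ i]), neighbours inside the piece ([8 * s ^ i], as
    [s >= 2 * (Delta + 2)]) and the at most 4 entries. *)
Lemma card_piece_fat j : j <= l.+1 -> #|P :&: fat j| <= 16 * s ^ (l.+1 - j).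
Proof.
move: {2}(l.+1 - j) (erefl (l.+1 - j)) => i.
elim: i j => [|i IH] j ei lej.
  have -> : j = l.+1 by lia.
  suff -> : P :&: fat l.+1 = set0 by rewrite cards0.
  by apply/setP => v; rewrite !inE /Y; case: (v \in fat _); rewrite ?andbF.
have jH : j < H by lia.
have := IH j.+1 ltac:(lia) ltac:(lia) => {}IH.
have h1 := @card_piece_sep j ltac:(lia).
have sub1 : P :&: fat j \subset (P :&: sep j) :|: (nbhd (P :&: fat j.+1) :|: entries).
  rewrite fatE // setIUr; apply: setUS; apply/subsetP => v; rewrite inE => /andP[vP].
  (* A neighbour outside of the piece must lie in [Y], since otherwise [fat_top_edge] would put it
     into the same piece. *)
  have out u : u \notin P -> u \in fat j.+1 ->
      (u == f v) || (f u == v) -> v \in entries.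
    move=> uP uf uv; rewrite inE vP /=.
    have [uY|uY] := boolP (u \in Y).
      case/orP: uv => /eqP e; first by rewrite nbhd_f // -e.
      by rewrite -e f_nbhd.
    case/negP: uP; rewrite inE uY /=; move: (vP); rewrite inE => /andP[vY /eqP vt].
    case/orP: uv => /eqP e; rewrite -vt.
      by rewrite e (fat_top_edge lH vY) // -e.
    by rewrite (fat_top_edge lH uY) e.
  rewrite {1}/nbhd 2![in X in X -> _]in_setU -orbA => /or3P[vf|/imsetP[u uf vu]|].
  - by rewrite in_setU (subsetP (sub_nbhd _)) // inE vP.
  - have [uP|uP] := boolP (u \in P); first by rewrite in_setU vu f_nbhd // inE uP.
    by apply/setUP; right; apply: (out u) => //; rewrite vu eqxx orbT.
  - rewrite inE => fv.
    have [fP|fP] := boolP (f v \in P); first by rewrite in_setU nbhd_f // inE fP.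
    by apply/setUP; right; apply: (out (f v)); rewrite ?eqxx.
have h2 := leq_trans (subset_leq_card sub1) (leq_card_setU _ _).
have h3 : #|nbhd (P :&: fat j.+1) :|: entries| <= (Delta + 2) * #|P :&: fat j.+1| + 4.
  apply: leq_trans (leq_card_setU _ _) _; apply: leq_add; first exact: card_nbhd.
  exact: card_entries.
have eS : s ^ (l.+1 - j) = s * s ^ (l.+1 - j.+1) by rewrite -expnS; congr expn; lia.
have h4 : 2 * (Delta + 2) * s ^ (l.+1 - j.+1) <= s ^ (l.+1 - j).
  by rewrite eS leq_mul2r s_large orbT.
have h5 : (Delta + 2) * #|P :&: fat j.+1| <= (Delta + 2) * (16 * s ^ (l.+1 - j.+1)).
  by rewrite leq_mul2l IH orbT.
have := sX_gt0 (l.+1 - j).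
by lia.
Qed.

End PieceBounds.

Definition height v := \max_(k < H.+1 | v \in fat k) k.

Lemma leq_height k v : k <= H -> (k <= height v) = (v \in fat k).
Proof.
move=> kH; apply/idP/idP => [le|vk]; last first.
  have kH' : k < H.+1 by [].
  exact: (@leq_bigmax_cond _ _ (fun k : 'I_H.+1 => k : nat) (Ordinal kH')).
(* At scale 1 the mass is the size of the subtree, which [v] itself makes larger than the sum over
   the children. So the default 0 of the maximum is a genuine height. *)
have v0 : v \in fat 0.
  apply: (subsetP (sep_fat (leq0n H))); rewrite inE; apply/or3P/Or32.
  rewrite /mass expn0 divn1; apply: leq_ltn_trans (card_sub_ch v).
  by apply: leq_sum => c _; rewrite divn1.
have [|j vj hj] := @eq_bigmax_cond _ [pred k : 'I_H.+1 | v \in fat k]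
   (fun k => k : nat).
  by apply/card_gt0P; exists ord0.
apply: (subsetP (fat_mono (leq_trans le _) _)) vj; last by rewrite -ltnS.
by rewrite /height hj.
Qed.

End Separators.
End RootedForest.

(* Each component of the functional graph of [f] contains one cycle; cutting
   one edge of it leaves a tree, rooted at a vertex of the cycle. *)
Lemma functional_graph_depth (V : finType) (f : V -> V) : exists depth : V -> nat,
  (forall v, 0 < depth v -> depth (f v) = (depth v).-1) /\
  (forall v, depth v = 0 -> iter (depth (f v)) f (f v) = v).
Proof.
(* [A v] is the cycle into which [v] runs. It is the same set for [f v], so picking an element of it
   gives one root per component. *)
pose A v := [set y | fconnect f v y && fconnect f (f y) y].
have A_f v : A (f v) = A v.
  apply/setP => y; rewrite !inE; apply/andP/andP => [] [vy yy]; split=> //.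
    exact: connect_trans (fconnect1 f v) vy.
  case/connectP: vy => -[|u p] /=; first by move=> _ e; rewrite -{1}e.
  by move=> /andP[/eqP<- pp] ->; apply/connectP; exists p.
have A_iter i v : A (iter i f v) = A v by elim: i => //= i IH; rewrite A_f.
have A_n0 v : exists y, y \in A v.
  have /loopingP/(_ (order f v)) := looping_order f v.
  case/trajectP => i lti e; exists (iter i f v); rewrite inE fconnect_iter /=.
  suff {2}-> : iter i f v = iter (order f v - i.+1) f (f (iter i f v)).
    exact: fconnect_iter.
  by rewrite -iterS -iterD subnK.
pose root v := odflt v [pick y in A v].
have root_A v : root v \in A v.
  by rewrite /root; case: pickP => //= no; case: (A_n0 v) => y; rewrite no.
have root_f v : root (f v) = root v.
  rewrite /root A_f; case: pickP => //= no; case: (A_n0 v) => y.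
  by rewrite no.
have reach v : exists k, iter k f v == root v.
  have := root_A v; rewrite inE => /andP[/iter_findex e _].
  by exists (findex f v (root v)); rewrite e.
pose depth v := ex_minn (reach v).
exists depth; split=> v.
  rewrite /depth; case: ex_minnP => [[//|k] kv kmin] _.
  case: ex_minnP => j /eqP jv jmin; apply/eqP; rewrite eqn_leq /=.
  rewrite jmin ?root_f -?iterSr //=.
  by rewrite -ltnS; apply: kmin; rewrite iterSr jv root_f.
rewrite /depth; case: ex_minnP => k /eqP kv _; case: ex_minnP => j /eqP jv _ k0.
by rewrite jv root_f -kv k0.
Qed.

Lemma forest_decomposition (V : finType) (f : V -> V) (Delta s H : nat) :
  (forall v, #|f @^-1: [set v]| <= Delta) -> 2 * (Delta + 2) <= s ->
  exists (h : V -> nat) (pi : nat -> V -> V),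
  [/\ forall v, h v <= H,
      forall v, h v <= (h (f v)).+1 /\ h (f v) <= (h v).+1,
      forall l v, l < H -> h v <= l -> h (f v) <= l -> pi l v = pi l (f v),
      forall k, k <= H -> #|[set v | k <= h v]| * s ^ k <= 4 * #|V|
    & forall l t k, l < H -> k <= l ->
      #|[set v | (h v == k) && (pi l v == t)]| <= 16 * s ^ (l.+1 - k)].
Proof.
move=> fib s_large; have [depth [dep_step dep_root]] := functional_graph_depth f.
pose h := height f depth s H; pose Y := fat f depth s H.
have hE k v : k <= H -> (k <= h v) = (v \in Y k).
  exact: (leq_height dep_step s_large).
have hH v : h v <= H by apply/bigmax_leqP => k _; rewrite -ltnS.
(* Height at most [l] means lying outside of [fat l.+1], which explains the shift of the index. *)
exists h, (fun l => top f depth (Y l.+1)); split=> //.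
- move=> v.
  have step k u w : (forall A : {set V}, u \in A -> w \in nbhd f A) ->
      k < H -> k.+1 <= h u -> k <= h w.
    move=> uw kH; rewrite !hE // ?(ltnW kH) // => uY.
    by rewrite /Y (fatE _ _ s_large) // inE uw ?orbT.
  have bound u w : (forall A : {set V}, u \in A -> w \in nbhd f A) -> h u <= (h w).+1.
    move=> uw; case e : (h u) => [//|k]; rewrite ltnS; apply: (step k u) => //.
      by rewrite -e.
    by rewrite e.
  by split; apply: bound => A; [exact: f_nbhd | exact: nbhd_f].
- move=> l v lH hv hf; apply: (fat_top_edge dep_step dep_root s_large) => //.
    by rewrite -hE // -ltnNge.
  by rewrite -hE // -ltnNge.
- move=> k kH; have -> : [set v | k <= h v] = Y k.
    by apply/setP => v; rewrite inE hE.
  exact: card_fat.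
- move=> l t k lH kl; set S := [set v | _].
  have [->|[v0 v0S]] := set_0Vmem S; first by rewrite cards0.
  have SP v : v \in S -> v \in piece f depth (Y l.+1) t :&: Y k.
    rewrite !inE => /andP[/eqP hv ->]; rewrite andbT -!hE //; last by lia.
    by rewrite hv leqnn -ltnNge ltnS kl.
  apply: leq_trans (subset_leq_card (introT subsetP SP)) _.
  apply: card_piece_fat => //; last by lia.
  by have := SP _ v0S; rewrite inE => /andP[/(mem_piece_top dep_step)].
Qed.

(** * Weighted rounding *)

Local Open Scope ring_scope.

(** There are fewer equations than unknowns; the solution is extended by 0 outside [F]. *)
Lemma weighted_kernel (R : fieldType) (P K : finType) (w : P -> K -> R)
    (F : {set P}) (A : {set K}) : (#|A| < #|F|)%N ->
  exists z : P -> R, [/\ exists2 p, p \in F & z p != 0,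
    forall p, p \notin F -> z p = 0 &
    forall k, k \in A -> \sum_p w p k * z p = 0].
Proof.
move=> ltAF.
pose M : 'M[R]_(#|F|, #|A|) := \matrix_(i, j) w (enum_val i) (enum_val j).
have /rowV0Pn[u /sub_kermxP uM u0] : kermx M != 0.
  rewrite kermx_eq0 /row_free neq_ltn.
  by rewrite (leq_ltn_trans (rank_leq_col M) ltAF).
have /set0Pn[p0 p0F] : F != set0 by rewrite -card_gt0 (leq_ltn_trans _ ltAF).
pose z p := if p \in F then u 0 (enum_rank_in p0F p) else 0.
exists z; split.
- have /existsP[i ui] : [exists i, u 0 i != 0].
    apply: contraNT u0 => /existsPn u0; apply/eqP/rowP => i.
    by rewrite mxE; apply/eqP; move: (u0 i); rewrite negbK.
  exists (enum_val i); first exact: enum_valP.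
  by rewrite /z enum_valP enum_valK_in.
- by move=> p pF; rewrite /z (negPf pF).
- move=> k kA.
  have /rowP/(_ (enum_rank_in kA k)) := uM; rewrite !mxE => uMk.
  apply: etrans uMk; rewrite (bigID (mem F)) /= [X in _ + X]big1 ?addr0; last first.
    by move=> p pF; rewrite /z (negPf pF) mulr0.
  rewrite big_enum_val /=; apply: eq_bigr => i _.
  by rewrite mxE enum_rankK_in // /z enum_valP enum_valK_in mulrC.
Qed.

(* Moving along a kernel direction until a first coordinate hits 0 or 1. *)
Lemma hit_boundary (R : realFieldType) (P : finType) (x z : P -> R)
    (F := [set p | 0 < x p < 1]) :
  (forall p, 0 <= x p <= 1) -> (forall p, p \notin F -> z p = 0) ->
  (exists2 p, p \in F & z p != 0) ->
  exists t, (forall p, 0 <= x p + t * z p <= 1) /\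
    exists2 p, p \in F & ~~ (0 < x p + t * z p < 1).
Proof.
move=> x01 zF [p0 p0F zp0].
pose b p := if 0 < z p then (1 - x p) / z p else - x p / z p.
pose A := [pred p | (p \in F) && (z p != 0)].
have Ap0 : A p0 by rewrite /= p0F.
case: (Order.TotalTheory.arg_minP b Ap0) => p1 /= /andP[p1F zp1] minp1.
have bE p : z p != 0 -> (b p * z p = 1 - x p /\ 0 < z p) \/
    (b p * z p = - x p /\ z p < 0).
  move=> zp; rewrite /b; case: ifPn => [zp_gt0|]; first by left; rewrite divfK.
  by rewrite -leNgt le_eqVlt (negPf zp) /= => zp_lt0; right; rewrite divfK.
have b_ge0 : 0 <= b p1.
  move: (x01 p1) => /andP[x0 x1]; rewrite /b; case: ifPn => [zp_gt0|].
    by rewrite divr_ge0 ?subr_ge0 // ltW.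
  by rewrite -leNgt => zp_le0; rewrite mulr_le0 // ?oppr_le0 // invr_le0.
exists (b p1); split=> [p|]; last first.
  exists p1 => //; case: (bE p1 zp1) => [[-> _]|[-> _]].
    by rewrite addrC subrK ltxx andbF.
  by rewrite subrr ltxx.
have /andP[x0 x1] := x01 p.
have [zp|zp] := eqVneq (z p) 0; first by rewrite zp mulr0 addr0 x0.
have pF : p \in F by apply: contraNT zp => /zF ->.
have bp : b p1 <= b p by apply: minp1; rewrite /= pF zp.
case: (bE p zp) => [[bz zs]|[bz zs]].
  have h1 : b p1 * z p <= b p * z p by rewrite ler_wpM2r // ltW.
  have h2 : 0 <= b p1 * z p by rewrite mulr_ge0 // ltW.
  by apply/andP; split; lra.
have h1 : b p * z p <= b p1 * z p by rewrite ler_wnM2r // ltW.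
have h2 : b p1 * z p <= 0 by rewrite mulr_ge0_le0 // ltW.
by apply/andP; split; lra.
Qed.

(** Keep exact the sums whose fractional coordinates have total weight above 1. As every [p] has
    weight at most 1, they are fewer than the fractional coordinates, so a kernel direction exists;
    move along it until one more coordinate is integral. *)
Lemma beck_fiala (R : realFieldType) (P K : finType) (w : P -> K -> R)
    (x : P -> R) :
  (forall p k, 0 <= w p k) -> (forall p, \sum_k w p k <= 1) ->
  (forall p, 0 <= x p <= 1) ->
  exists y : P -> bool,
    forall k, `|\sum_p w p k * (y p)%:R - \sum_p w p k * x p| <= 1.
Proof.
move=> w_ge0 w_le1 x01.
(* The induction needs in addition that integral coordinates stay frozen. *)
suff [y [_ yk]] : exists y : P -> bool,
    (forall p, ~~ (0 < x p < 1) -> (y p)%:R = x p) /\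
    (forall k, `|\sum_p w p k * (y p)%:R - \sum_p w p k * x p| <= 1).
  by exists y.
have [N] := ubnP #|[set p | 0 < x p < 1]|; elim: N => // N IH in x x01 *.
rewrite ltnS => leN; set F := [set p | 0 < x p < 1] in leN *.
have [F0|Fn0] := eqVneq F set0.
  have fE p : (x p == 1)%:R = x p.
    have /negbT : p \in F = false by rewrite F0 inE.
    have /andP[] := x01 p.
    rewrite inE !le_eqVlt => /orP[/eqP<- _ _|xp /orP[/eqP->|xp1]].
    - by rewrite eq_sym oner_eq0.
    - by rewrite eqxx.
    - by rewrite xp xp1.
  exists (fun p => x p == 1); split=> // k.
  by under eq_bigr do rewrite fE; rewrite subrr normr0.
pose A := [set k | 1 < \sum_(p in F) w p k].
have ltAF : (#|A| < #|F|)%N.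
  have [->|An0] := eqVneq A set0; first by rewrite cards0 card_gt0.
  rewrite -(ltr_nat R).
  have h1 : #|A|%:R < \sum_(k in A) \sum_(p in F) w p k.
    rewrite -sum1_card natr_sum; apply: ltr_sum => [|k]; last by rewrite inE.
    by have /set0Pn[k kA] := An0; apply/hasP; exists k; rewrite ?mem_index_enum.
  apply: lt_le_trans h1 _; rewrite exchange_big /= -sum1_card natr_sum.
  apply: ler_sum => p _; apply: le_trans (w_le1 p).
  by rewrite [leRHS](bigID (mem A)) /= lerDl sumr_ge0.
have [z [zn0 zF zA]] := weighted_kernel w ltAF.
have [t [x'01 [p1 p1F p1E]]] := hit_boundary x01 zF zn0.
have [|y [yE yk]] := IH _ x'01.
  apply: leq_trans leN; apply: proper_card; apply/properP; split.
    apply/subsetP => p; rewrite !inE; apply: contraTT => pF.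
    by rewrite zF ?inE // mulr0 addr0.
  by exists p1 => //; rewrite inE.
have yE' p : p \notin F -> (y p)%:R = x p.
  move=> pF; have := pF; rewrite inE => pF'.
  by rewrite yE zF ?mulr0 ?addr0.
exists y; split=> [p pF|k]; first by apply: yE'; rewrite inE.
case: (boolP (k \in A)) => kA.
  suff -> : \sum_p w p k * x p = \sum_p w p k * (x p + t * z p) by exact: yk.
  under [RHS]eq_bigr do rewrite mulrDr mulrCA.
  by rewrite big_split /= -mulr_sumr zA // mulr0 addr0.
(* A sum given up has fractional weight at most 1, and from here on only those coordinates move,
   each by at most 1. *)
rewrite -sumrB (bigID (mem F)) /= [X in _ + X]big1 ?addr0; last first.
  by move=> p pF; rewrite yE' // subrr.
apply: (@le_trans _ _ (\sum_(p in F) w p k)); last by move: kA; rewrite inE -leNgt.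
apply: le_trans (ler_norm_sum _ _ _) _; apply: ler_sum => p _.
rewrite -mulrBr normrM ger0_norm // ler_piMr // ler_norml.
by have /andP[] := x01 p; case: (y p) => /= *; apply/andP; split; lra.
Qed.

(** One bit per round, each round halving all sums with error 1. Later halvings shrink earlier
    errors, so they add up to a geometric series below 2. *)
Lemma balanced_labelling (R : realFieldType) (P : finType) r (K : finType)
    (w : P -> K -> R) :
  (forall p k, 0 <= w p k) -> (forall p, \sum_k w p k <= 1) ->
  exists lam : P -> r.-tuple bool, forall k b,
    \sum_(p | lam p == b) w p k <= (\sum_p w p k) / 2 ^+ r + 2.
Proof.
move=> w_ge0 w_le1.
suff [lam lamP] : exists lam : P -> r.-tuple bool, forall k b,
    \sum_(p | lam p == b) w p k <=
      (\sum_p w p k) / 2 ^+ r + (2 - 2 / 2 ^+ r).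
  exists lam => k b; apply: le_trans (lamP k b) _.
  by rewrite lerD2l gerBl divr_ge0 // exprn_ge0.
elim: r => [|r IH] in K w w_ge0 w_le1 *.
  exists (fun=> [tuple]) => k b; rewrite expr0 !divr1 subrr addr0.
  by rewrite big_mkcond ler_sum // => p _; case: ifP.
have [|y yP] := @beck_fiala R P K w (fun=> 2^-1) w_ge0 w_le1.
  by move=> _; apply/andP; split; lra.
(* Splitting every key by the first bit lets the remaining bits balance both halves at once, while
   the total weight of each [p] is unchanged. *)
pose w' p (kb : K * bool) := if y p == kb.2 then w p kb.1 else 0.
have [||lam lamP] := IH _ w'.
- by move=> p kb; rewrite /w'; case: ifP.
- move=> p; rewrite -(pair_big predT predT (fun k b => w' p (k, b))) /=.
  apply: le_trans (w_le1 p); apply: ler_sum => k _.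
  by rewrite big_bool /w' /=; case: (y p) => /=; rewrite ?addr0 ?add0r.
exists (fun p => [tuple of y p :: lam p]) => k; case/tupleP=> b0 b.
have -> : \sum_(p | [tuple of y p :: lam p] == [tuple of b0 :: b]) w p k =
    \sum_(p | lam p == b) w' p (k, b0).
  rewrite [RHS]big_mkcond [LHS]big_mkcond; apply: eq_bigr => p _.
  have -> : ([tuple of y p :: lam p] == [tuple of b0 :: b]) =
      (lam p == b) && (y p == b0).
    by rewrite -!val_eqE /= eqseq_cons andbC.
  by rewrite /w' /=; case: eqP; case: eqP.
apply: le_trans (lamP _ _) _.
have half : \sum_p w' p (k, b0) <= (\sum_p w p k) / 2 + 1.
  have := yP k; rewrite ler_norml -mulr_suml => /andP[lo hi].
  have tot : \sum_p w p k * (y p)%:R + \sum_p w p k * (~~ y p)%:R = \sum_p w p k.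
    rewrite -big_split /=; apply: eq_bigr => p _.
    by case: (y p); rewrite /= mulr0 mulr1 ?addr0 ?add0r.
  have -> : \sum_p w' p (k, b0) =
      \sum_p w p k * (y p == b0)%:R.
    by apply: eq_bigr => p _; rewrite /w' /=; case: ifP; rewrite ?mulr1 ?mulr0.
  case: (b0); first by under eq_bigr do rewrite eqb_id; lra.
  by under eq_bigr do rewrite eqbF_neg; lra.
have q0 : (0 : R) < (2 ^+ r)^-1 by rewrite invr_gt0 exprn_gt0.
have -> : (2 ^+ r.+1)^-1 = (2 ^+ r)^-1 / 2 :> R by rewrite exprS invfM mulrC.
have : (\sum_p w' p (k, b0)) / 2 ^+ r <=
    ((\sum_p w p k) / 2 + 1) / 2 ^+ r by rewrite ler_wpM2r // ltW.
by lra.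
Qed.

(** * Labelling the pieces *)

(** At height [k] a piece carries weight at most [16 * s ^ l.+1 * 2 ^ k]; the base [2 * s] instead
    of [s] makes the sum over [k] geometric. *)
Lemma piece_weight (V : finType) (h : V -> nat) (pi : nat -> V -> V)
    (H s l : nat) (t : V) :
  (forall l t k, (l < H)%N -> (k <= l)%N ->
    (#|[set v | (h v == k) && (pi l v == t)]| <= 16 * s ^ (l.+1 - k))%N) ->
  (l < H)%N ->
  (\sum_(v | (h v <= l) && (pi l v == t)) (2 * s) ^ h v <= 32 * s * (2 * s) ^ l)%N.
Proof.
move=> hcnt lH.
have step v : (h v <= l)%N -> (h v < l.+1)%N by [].
rewrite (partition_big (fun v => inord (h v) : 'I_l.+1) predT) //=.
apply: (@leq_trans (\sum_(k < l.+1) 16 * s ^ l.+1 * 2 ^ k)); last first.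
  rewrite -big_distrr /=; have : (\sum_(k < l.+1) 2 ^ k < 2 ^ l.+1)%N.
    elim: (l.+1) => [|n IH]; first by rewrite big_ord0.
    by rewrite big_ord_recr expnS mul2n -addnn -addSn leq_add2r.
  move=> lt; apply: (@leq_trans (16 * s ^ l.+1 * 2 ^ l.+1)).
    by rewrite leq_mul2l ltnW ?orbT.
  by rewrite expnMn !expnS; apply: eq_leq; lia.
apply: leq_sum => k _.
have kl : (k <= l)%N by rewrite -ltnS.
apply: (@leq_trans (\sum_(v in [set v | (h v == k) && (pi l v == t)]) (2 * s) ^ k)).
  rewrite [leqRHS]big_mkcond /= [leqLHS]big_mkcond; apply: leq_sum => v _.
  rewrite inE; case: ifP => // /andP[/andP[hl ->]].
  by rewrite -val_eqE /= inordK // => /eqP->; rewrite eqxx.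
rewrite sum_nat_const; apply: leq_trans (leq_mul (hcnt l t k lH kl) (leqnn _)) _.
have -> : (s ^ l.+1 = s ^ (l.+1 - k) * s ^ k)%N by rewrite -expnD subnK // leqW.
by rewrite expnMn; lia.
Qed.

Section Coordinate.

Variables (R : realFieldType) (V K : finType) (kappa : V -> K) (h : V -> nat)
  (eta : K -> nat) (pi : nat -> V -> V) (H s r : nat).
Hypothesis h_eta : forall v, h v = eta (kappa v).
Hypothesis h_piece : forall l t k, (l < H)%N -> (k <= l)%N ->
  (#|[set v | (h v == k) && (pi l v == t)]| <= 16 * s ^ (l.+1 - k))%N.
Hypothesis s_gt0 : (0 < s)%N.
Hypothesis r_large : (4 * s <= 2 ^ r)%N.

Local Notation label := (r.-tuple bool).
Local Notation word := {ffun 'I_H -> label}.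

Definition nolabel : label := [tuple of nseq r false].

(** Blank letters below [l] give words of all lengths the same finite type. *)
Definition word_above (lam : nat -> V -> label) l v : word :=
  [ffun j : 'I_H => if (l <= j)%N then lam j (pi j v) else nolabel].

Lemma word_above_eq lam lam' l v : (forall j, (l <= j)%N -> lam j = lam' j) ->
  word_above lam l v = word_above lam' l v.
Proof. by move=> e; apply/ffunP => j; rewrite !ffunE; case: ifP => // /e->. Qed.

Definition class lam l k w := [set v | (kappa v == k) && (word_above lam l v == w)].

(** The pieces of level [l] are rounded with weights [(2 * s) ^ h v], normalised by [c]. All
    vertices of a class have height [eta k], so the error 2 becomes [2 * c / (2 * s) ^ eta k]
    vertices. *)
Lemma label_step lam l : (l < H)%N -> exists mu : V -> label,
  forall k w b, (eta k <= l)%N ->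
    #|[set v in class lam l.+1 k w | mu (pi l v) == b]|%:R <=
      #|class lam l.+1 k w|%:R / 2 ^+ r + (64 * s)%:R * (2 * s)%:R ^+ (l - eta k) :> R.
Proof.
move=> lH.
pose G : R := (2 * s)%:R; pose c : R := (32 * s)%:R * G ^+ l.
have G0 : 0 < G by rewrite ltr0n muln_gt0.
have c0 : 0 < c by rewrite mulr_gt0 ?ltr0n ?muln_gt0 ?exprn_gt0.
pose kw v := (kappa v, word_above lam l.+1 v).
pose w t x : R := (\sum_(v | [&& h v <= l, pi l v == t & kw v == x]) (2 * s) ^ h v)%N%:R / c.
have [||mu muP] := @balanced_labelling R V r _ w.
- by move=> t x; rewrite divr_ge0 // ltW.
- move=> t; rewrite -mulr_suml ler_pdivrMr // mul1r -natr_sum.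
  rewrite /c /G -natrX -natrM ler_nat; apply: leq_trans (piece_weight t h_piece lH).
  rewrite [leqRHS](partition_big kw predT) //=; apply: eq_leq.
  by apply: eq_bigr => x _; apply: eq_bigl => v; rewrite andbA.
exists mu => k u b ek.
have wE (Q : pred V) : \sum_(t | Q t) w t (k, u) =
    #|[set v in class lam l.+1 k u | Q (pi l v)]|%:R * G ^+ eta k / c.
  rewrite -mulr_suml -natr_sum; congr (_ / c).
  rewrite /G -natrX -natrM; congr (_%:R).
  rewrite -sum_nat_const [RHS](partition_big (pi l) Q) /=; last first.
    by move=> v; rewrite inE => /andP[].
  apply: eq_bigr => t Qt; apply: congr_big => // v; last first.
    by move=> /and3P[_ _ /eqP[<- _]]; rewrite h_eta.
  rewrite !inE xpair_eqE; case: (pi l v =P t) => [->|]; rewrite ?andbF //= Qt !andbT /=.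
  by case: (kappa v =P k) => [e|]; rewrite ?andbF //= h_eta e ek.
have := muP (k, u) b.
rewrite wE (wE predT) /=.
have -> : [set v in class lam l.+1 k u | predT (pi l v)] = class lam l.+1 k u.
  by apply/setP => v; rewrite !inE andbT.
have Ge : 0 < G ^+ eta k by rewrite exprn_gt0.
have cE : c = (32 * s)%:R * G ^+ (l - eta k) * G ^+ eta k.
  by rewrite -mulrA -exprD subnK.
set X := #|_|%:R; set Y := #|_|%:R => le.
have Gc : 0 < G ^+ eta k / c by rewrite divr_gt0.
rewrite -(ler_pM2r Gc).
have e64 : (64 * s)%:R = 2 * (32 * s)%:R :> R by rewrite -natrM; congr (_%:R); lia.
have -> : (Y / 2 ^+ r + (64 * s)%:R * G ^+ (l - eta k)) * (G ^+ eta k / c) =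
    Y * G ^+ eta k / c / 2 ^+ r + 2.
  have c1 : (32 * s)%:R * G ^+ (l - eta k) * G ^+ eta k / c = 1.
    by rewrite -cE divff ?gt_eqF.
  rewrite mulrDl; congr (_ + _); first by rewrite -!mulrA; congr (Y * _); rewrite mulrC -mulrA.
  by rewrite e64 -[RHS]mulr1 -[X in _ = _ * X]c1 !mulrA.
by rewrite mulrA.
Qed.

(** Levels are labelled from the top down. The error inherited from level [l.+1] grows by [2 * s]
    and shrinks by [2 ^ r >= 4 * s], so it fills half of the bound, and [label_step] the other
    half. *)
Lemma labels_exist : exists lam : nat -> V -> label, forall l k w,
  (l <= H)%N -> (eta k <= l)%N ->
  #|class lam l k w|%:R <= #|[set v | kappa v == k]|%:R / (2 ^+ r) ^+ (H - l) +
     (128 * s)%:R * (2 * s)%:R ^+ (l - eta k) :> R.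
Proof.
suff main n : (n <= H)%N -> exists lam : nat -> V -> label, forall l k w,
    (H - n <= l)%N -> (l <= H)%N -> (eta k <= l)%N ->
  #|class lam l k w|%:R <= #|[set v | kappa v == k]|%:R / (2 ^+ r) ^+ (H - l) +
     (128 * s)%:R * (2 * s)%:R ^+ (l - eta k) :> R.
  by have [lam P] := main H (leqnn H); exists lam => l k w; apply: P; rewrite subnn.
have err0 k l : 0 <= (128 * s)%:R * (2 * s)%:R ^+ (l - eta k) :> R.
  by rewrite mulr_ge0 // exprn_ge0.
elim: n => [_|n IH nH].
  exists (fun _ _ => nolabel) => l k w; rewrite subn0 => Hl lH _.
  have -> : l = H by apply/eqP; rewrite eqn_leq lH.
  rewrite subnn expr0 divr1; apply: ler_wpDr => //.
  rewrite ler_nat; apply/subset_leq_card/subsetP => v.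
  by rewrite !inE => /andP[].
have [lam P] := IH (ltnW nH).
pose l0 := (H - n.+1)%N.
have l0H : (l0 < H)%N by rewrite /l0; lia.
have el0 : l0.+1 = (H - n)%N by rewrite /l0; lia.
have [mu muP] := label_step lam l0H.
exists (fun j => if j == l0 then mu else lam j) => l k w le_l lH ek.
set lam' := fun j => _.
have same j v : (l0 < j)%N -> word_above lam' j v = word_above lam j v.
  move=> lj; apply: word_above_eq => i ji; rewrite /lam'.
  by case: eqP => // e; move: lj ji; rewrite e; lia.
move: le_l; rewrite leq_eqVlt -/l0 => /orP[/eqP el|lt]; last first.
  have -> : class lam' l k w = class lam l k w by apply/setP => v; rewrite !inE same.
  by apply: P => //; rewrite -el0.
rewrite -el in lH ek *.
pose j0 := Ordinal l0H.
pose w' : word := [ffun j : 'I_H => if (l0.+1 <= j)%N then w j else nolabel].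
have sub : class lam' l0 k w \subset [set v in class lam l0.+1 k w' | mu (pi l0 v) == w j0].
  apply/subsetP => v; rewrite !inE => /andP[-> /eqP wE] /=; apply/andP; split.
    apply/eqP/ffunP => j; rewrite -same // !ffunE -wE ffunE.
    by case: ifP => // /ltnW->.
  by rewrite -wE ffunE leqnn /lam' eqxx.
apply: le_trans (_ : #|[set v in class lam l0.+1 k w' | mu (pi l0 v) == w j0]|%:R <= _).
  by rewrite ler_nat subset_leq_card.
apply: le_trans (muP k w' _ ek) _.
have := P l0.+1 k w'; rewrite el0 leqnn -el0 => /(_ isT l0H (leqW ek)).
set X := #|class _ _ _ _|%:R; set Y := #|_|%:R => le.
have q0 : 0 < 2 ^+ r :> R by rewrite exprn_gt0.
have -> : (H - l0 = (H - l0.+1).+1)%N by lia.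
have eG : (2 * s)%:R ^+ (l0.+1 - eta k) = (2 * s)%:R * (2 * s)%:R ^+ (l0 - eta k) :> R.
  by rewrite subSn // exprS.
rewrite eG in le; set g := (2 * s)%:R ^+ (l0 - eta k) in le *.
have g0 : 0 <= g by rewrite exprn_ge0.
have le1 : X / 2 ^+ r <= (Y / (2 ^+ r) ^+ (H - l0.+1) + (128 * s)%:R * ((2 * s)%:R * g)) / 2 ^+ r.
  by rewrite ler_pM2r ?invr_gt0.
have le2 : (2 * s)%:R / 2 ^+ r <= 2^-1 :> R.
  rewrite ler_pdivrMr // -ler_pdivrMl ?invr_gt0 // invrK -natrM -natrX ler_nat.
  by apply: leq_trans r_large; lia.
have le3 : (128 * s)%:R * g * ((2 * s)%:R / 2 ^+ r) <= (128 * s)%:R * g * 2^-1.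
  by rewrite ler_wpM2l // mulr_ge0.
have e1 : (Y / (2 ^+ r) ^+ (H - l0.+1) + (128 * s)%:R * ((2 * s)%:R * g)) / 2 ^+ r =
   Y / (2 ^+ r) ^+ (H - l0.+1).+1 + (128 * s)%:R * g * ((2 * s)%:R / 2 ^+ r).
  rewrite mulrDl exprS invfM; congr (_ + _); last first.
    by rewrite -!mulrA; congr (_ * _); rewrite mulrCA.
  by rewrite -!mulrA; congr (_ * _); rewrite mulrC.
have e2 : (128 * s)%:R = 2 * (64 * s)%:R :> R by rewrite -natrM; congr (_%:R); lia.
have e3 : (128 * s)%:R * g * 2^-1 = (64 * s)%:R * g by rewrite e2; lra.
have e4 : (128 * s)%:R * g = 2 * ((64 * s)%:R * g) by rewrite e2 mulrA.
by rewrite e1 in le1; rewrite e4; lra.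
Qed.

End Coordinate.

Section AllCoordinates.

Variables (R : realFieldType) (V : finType) (d : nat) (h : 'I_d -> V -> nat)
  (pi : 'I_d -> nat -> V -> V) (H s r : nat).
Hypothesis h_le : forall i v, (h i v <= H)%N.
Hypothesis h_piece : forall i l t k, (l < H)%N -> (k <= l)%N ->
  (#|[set v | (h i v == k) && (pi i l v == t)]| <= 16 * s ^ (l.+1 - k))%N.
Hypothesis s_gt0 : (0 < s)%N.
Hypothesis r_large : (4 * s <= 2 ^ r)%N.

Local Notation label := (r.-tuple bool).
Local Notation word := {ffun 'I_H -> label}.

Definition type_of v : {ffun 'I_d -> 'I_H.+1} := [ffun i => inord (h i v)].

Definition word_of (lam : 'I_d -> nat -> V -> label) i v : word :=
  word_above (pi i) H (lam i) (h i v) v.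

(** Coordinates are treated one at a time, a class being the type together with the earlier words.
    Each word stops at its own height, where the error is [128 * s]; later coordinates never enlarge
    earlier errors, hence the factor [d]. *)
Lemma words_exist : exists lam : 'I_d -> nat -> V -> label,
  forall (tau : {ffun 'I_d -> 'I_H.+1}) (w : {ffun 'I_d -> word}),
  #|[set v | (type_of v == tau) && [forall i, word_of lam i v == w i]]|%:R <=
    #|[set v | type_of v == tau]|%:R * \prod_i ((2 ^+ r) ^+ (H - tau i))^-1 +
    (d * (128 * s))%:R :> R.
Proof.
pose w0 : word := [ffun=> nolabel r].
pose pre n lam v : {ffun 'I_d -> 'I_H.+1} * {ffun 'I_d -> word} :=
  (type_of v, [ffun i : 'I_d => if (i < n)%N then word_of lam i v else w0]).
suff main n : (n <= d)%N -> exists lam, forall tau w,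
    #|[set v | pre n lam v == (tau, w)]|%:R <=
    #|[set v | type_of v == tau]|%:R *
      \prod_(i < d | (i < n)%N) ((2 ^+ r) ^+ (H - tau i))^-1 +
    (n * (128 * s))%:R :> R.
  have [lam P] := main d (leqnn d); exists lam => tau w.
  apply: le_trans (le_trans (P tau w) _); last first.
    rewrite lerD2r ler_wpM2l // [leLHS](eq_bigl xpredT) // => i.
    by rewrite ltn_ord.
  rewrite ler_nat; apply/subset_leq_card/subsetP => v.
  rewrite !inE => /andP[/eqP<- /forallP e]; rewrite xpair_eqE eqxx /=.
  by apply/eqP/ffunP => i; rewrite ffunE ltn_ord (eqP (e i)).
elim: n => [_|n IH nd].
  exists (fun _ _ _ => nolabel r) => tau w; rewrite big_pred0 // mulr1 mul0n addr0.
  rewrite ler_nat; apply/subset_leq_card/subsetP => v.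
  by rewrite !inE xpair_eqE => /andP[].
have [lam P] := IH (ltnW nd); pose i0 := Ordinal nd.
have heta v : h i0 v = (pre n lam v).1 i0 by rewrite /pre /= ffunE inordK // ltnS.
have [mu muP] := @labels_exist R V _ (pre n lam) (h i0) (fun k => k.1 i0 : nat)
  (pi i0) H s r heta (@h_piece i0) s_gt0 r_large.
pose lam' i := if i == i0 then mu else lam i.
exists lam' => tau w.
pose w' : {ffun 'I_d -> word} := [ffun i : 'I_d => if (i < n)%N then w i else w0].
have lamE (i : 'I_d) v : (i < n)%N -> word_of lam' i v = word_of lam i v.
  by move=> lt; rewrite /word_of /lam'; case: eqP => // e; move: lt; rewrite e ltnn.
have sub : [set v | pre n.+1 lam' v == (tau, w)] \subset
    @class V _ (pre n lam) (pi i0) H r mu (tau i0) (tau, w') (w i0).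
  apply/subsetP => v; rewrite !inE !xpair_eqE => /andP[/eqP <- /eqP wE].
  rewrite eqxx -wE; apply/andP; split.
    apply/eqP/ffunP => i; rewrite !ffunE -wE ffunE; case: ifP => // lt.
    by rewrite lamE // ltnW.
  by rewrite !ffunE /= leqnn /word_of /lam' eqxx inordK // ltnS.
have tH : (tau i0 <= H)%N by rewrite -ltnS.
have := muP (tau i0 : nat) (tau, w') (w i0) tH (leqnn _).
rewrite subnn expr0 mulr1 => le1.
have le0 := subset_leq_card sub; rewrite -(ler_nat R) in le0.
apply: le_trans le0 _; apply: le_trans le1 _.
set e := ((2 ^+ r) ^+ (H - tau i0))^-1.
have e0 : 0 <= e by rewrite invr_ge0 !exprn_ge0.
have e1 : e <= 1.
  by rewrite invf_le1 ?exprn_gt0 //; do 2 apply: exprn_ege1; rewrite ler1n.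
have -> : \prod_(i < d | (i < n.+1)%N) ((2 ^+ r) ^+ (H - tau i))^-1 =
    \prod_(i < d | (i < n)%N) ((2 ^+ r) ^+ (H - tau i))^-1 * e.
  rewrite (bigD1 i0) //= mulrC; congr (_ * _); apply: eq_bigl => i.
  by rewrite ltnS andbC -val_eqE /= ltn_neqAle.
have le2 : #|[set v | pre n lam v == (tau, w')]|%:R * e <=
  (#|[set v | type_of v == tau]|%:R *
      \prod_(i < d | (i < n)%N) ((2 ^+ r) ^+ (H - tau i))^-1 +
    (n * (128 * s))%:R) * e by rewrite ler_wpM2r.
have le3 : (n * (128 * s))%:R * e <= (n * (128 * s))%:R by rewrite ler_piMr.
rewrite mulSn natrD mulrA.
by rewrite mulrDl in le2; lra.
Qed.

End AllCoordinates.

Local Close Scope ring_scope.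

(** * The host graph *)

Section Host.

Variables (d H r N : nat) (cap : {ffun 'I_d -> 'I_H.+1} -> nat).

Local Notation label := (r.-tuple bool).
Local Notation word := {ffun 'I_H -> label}.
Local Notation type := {ffun 'I_d -> 'I_H.+1}.
Local Notation words := {ffun 'I_d -> word}.
Local Notation slot := (type * words * 'I_N)%type.

Definition clean (tau : type) : {set words} :=
  [set w : words | [forall i, forall j : 'I_H, (j < tau i) ==> (w i j == nolabel r)]].

(** Slots that are not valid stay in the host as isolated vertices, so the vertex type is a plain
    product. *)
Definition valid (x : slot) := (x.1.2 \in clean x.1.1) && (x.2 < cap x.1.1).

Definition near (i : 'I_d) (tau tau' : type) :=
  (tau i <= (tau' i).+1) && (tau' i <= (tau i).+1).

Definition agree (i : 'I_d) (tau tau' : type) (w w' : words) :=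
  [forall j : 'I_H, (maxn (tau i) (tau' i) <= j) ==> (w i j == w' i j)].

Definition host_adj : rel slot := fun x y =>
  [&& x != y, valid x, valid y &
    [exists i, near i x.1.1 y.1.1 && agree i x.1.1 y.1.1 x.1.2 y.1.2]].

Lemma host_sym : symmetric host_adj.
Proof.
move=> x y; rewrite /host_adj eq_sym; case: (y != x) => //=.
rewrite andbCA; congr [&& _, _ & _]; apply: eq_existsb => i.
congr (_ && _); first by rewrite /near andbC.
by apply: eq_forallb => j; rewrite maxnC eq_sym.
Qed.

Lemma host_irr : irreflexive host_adj.
Proof. by move=> x; rewrite /host_adj eqxx. Qed.

Definition host : sgraph := SGraph host_sym host_irr.

Let q := 2 ^ r.

Definition layer_size (tau : type) := cap tau * \prod_i q ^ (H - tau i).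

Lemma card_label : #|{: label}| = q.
Proof. by rewrite card_tuple card_bool. Qed.

Lemma card_clean_word (t : nat) : t <= H ->
  #|[set u : word | [forall j : 'I_H, (j < t) ==> (u j == nolabel r)]]| = q ^ (H - t).
Proof.
move=> tH; rewrite -card_label.
have <- : #|[pred j : 'I_H | t <= j]| = H - t.
  rewrite -sum1_card -(big_mkord (fun j => t <= j) (fun=> 1)).
  have <- := @big_nat_widenl _ 0 addn t 0 H xpredT (fun=> 1) (leq0n t).
  by rewrite sum_nat_const_nat muln1.
rewrite -(card_pffun_on (nolabel r)); apply: eq_card => u; rewrite inE.
apply/forallP/pffun_onP => [h|[/supportP h _] j].
  split=> //; apply/supportP => j; rewrite inE -ltnNge => jt.
  by apply/eqP; apply: (implyP (h j)).
by apply/implyP => jt; apply/eqP/h; rewrite inE -ltnNge.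
Qed.

Lemma card_clean tau : #|clean tau| = \prod_i q ^ (H - tau i).
Proof.
pose F i := mem [set u : word | [forall j : 'I_H, (j < tau i) ==> (u j == nolabel r)]].
have -> : #|clean tau| = #|family F|.
  apply: eq_card => w; rewrite inE; apply/forallP/familyP => h i; move: (h i);
  by rewrite /F inE.
rewrite card_family foldrE big_map big_enum /=.
by apply: eq_bigr => i _; rewrite card_clean_word // -ltnS.
Qed.

Lemma card_slots tau (B : {set words}) :
  #|[set x : slot | [&& x.1.1 == tau, x.1.2 \in B & x.2 < cap x.1.1]]| <= cap tau * #|B|.
Proof.
pose g (x : words * 'I_N) : slot := (tau, x.1, x.2).
apply: (@leq_trans #|g @: setX B [set j : 'I_N | j < cap tau]|).
  apply/subset_leq_card/subsetP => -[[t w] j]; rewrite !inE /= => /and3P[/eqP e wB jc].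
  apply/imsetP; exists (w, j); last by rewrite /g e.
  by rewrite !inE /= -e jc andbT.
apply: leq_trans (leq_imset_card _ _) _.
rewrite cardsX mulnC leq_mul2r; apply/orP; right.
have [lt|ge] := ltnP (cap tau) N; last first.
  by apply: leq_trans (max_card _) _; rewrite card_ord.
rewrite -sum1dep_card -(big_mkord (fun j => j < cap tau) (fun=> 1)).
have <- := @big_nat_widen _ 0 addn 0 (cap tau) N xpredT (fun=> 1) (ltnW lt).
by rewrite sum_nat_const_nat subn0 muln1.
Qed.

Lemma card_layer tau : #|[set x : slot | valid x && (x.1.1 == tau)]| <= layer_size tau.
Proof.
rewrite /layer_size -card_clean; apply: leq_trans (card_slots _ _).
apply/subset_leq_card/subsetP => x; rewrite !inE => /andP[/andP[xc ->] /eqP e].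
by rewrite e eqxx andbT; move: xc; rewrite e inE.
Qed.

(* A word of height [tau' i] agreeing with a given word above [tau i] has at most
   one free letter. *)
Lemma card_agree (x : slot) i tau' : near i x.1.1 tau' ->
  #|[set y : slot | [&& valid y, y.1.1 == tau' & agree i x.1.1 tau' x.1.2 y.1.2]]| * q ^ H
    <= layer_size tau' * q ^ (tau' i).+1.
Proof.
case: x => [[tau w0] jx] /= /andP[n1 n2].
pose C k := [set u : word | [forall j : 'I_H, (j < tau' k) ==> (u j == nolabel r)]].
pose A := [set u in C i | [forall j : 'I_H, (maxn (tau i) (tau' i) <= j) ==> (w0 i j == u j)]].
have cardA : #|A| <= q.
  (* The free letter can only sit at position [tau' i]; [insub] covers [tau' i = H], where there is
     none. *)
  rewrite -card_label; pose g (u : word) : label :=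
    if insub (tau' i : nat) is Some j then u j else nolabel r.
  rewrite -(@card_in_imset _ _ g (mem A)) ?max_card // => u v.
  rewrite !inE => /andP[/forallP u1 /forallP u2] /andP[/forallP v1 /forallP v2].
  rewrite /g => guv; apply/ffunP => j.
  have [lt|ge] := ltnP j (tau' i).
    by rewrite (eqP (implyP (u1 j) lt)) (eqP (implyP (v1 j) lt)).
  have [le|lt] := leqP (maxn (tau i) (tau' i)) j.
    by rewrite -(eqP (implyP (u2 j) le)) -(eqP (implyP (v2 j) le)).
  have ej : tau' i = j :> nat by move: lt ge n1 n2; clear; lia.
  by move: guv; rewrite ej valK.
pose F k := mem (if k == i then A else C k).
have FE k u : (u \in F k) = (u \in if k == i then A else C k) by [].
pose B := [set w : words | (w \in clean tau') && agree i tau tau' w0 w].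
have cardB : #|B| = #|A| * \prod_(k | k != i) q ^ (H - tau' k).
  have -> : #|B| = #|family F|.
    apply: eq_card => w; rewrite !inE; apply/andP/familyP => [[/forallP wc wa] k|h].
      rewrite FE; case: eqP => [->|_]; rewrite !inE; last exact: wc.
      by apply/andP; split; [exact: wc | exact: wa].
    split; last by have := h i; rewrite FE eqxx inE => /andP[].
    apply/forallP => k; have := h k; rewrite FE; case: eqP => [->|_]; rewrite !inE //.
    by case/andP.
  rewrite card_family foldrE big_map big_enum /= (bigD1 i) //=; congr (_ * _).
    by apply: eq_card => u; rewrite FE eqxx.
  apply: eq_bigr => k ki; have tk : tau' k <= H by rewrite -ltnS.
  rewrite -(card_clean_word tk).
  by apply: eq_card => u; rewrite FE (negPf ki).
apply: (@leq_trans (cap tau' * #|B| * q ^ H)).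
  rewrite leq_mul2r; apply/orP; right; apply: leq_trans (card_slots _ _).
  apply/subset_leq_card/subsetP => y; rewrite !inE => /and3P[/andP[yc yi] /eqP e ya].
  by rewrite yi -e eqxx andbT /=; move: yc ya; rewrite !inE e => -> ->.
have tH : tau' i <= H by rewrite -ltnS.
rewrite cardB /layer_size [X in _ <= _ * X * _](bigD1 i) //= expnS.
have -> : q ^ H = q ^ (H - tau' i) * q ^ tau' i by rewrite -expnD subnK.
set P := \prod_(_ | _) _; set a := q ^ (H - _); set b := q ^ _.
have -> : cap tau' * (#|A| * P) * (a * b) = #|A| * (cap tau' * P * a * b) by ring.
have -> : cap tau' * (a * P) * (q * b) = q * (cap tau' * P * a * b) by ring.
by rewrite leq_mul2r cardA orbT.
Qed.

(** Every edge is charged to an ordered pair of types and a coordinate in which its ends are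
    compatible; [card_agree] counts the second ends. The factor [q ^ H] avoids division. *)
Lemma card_host_edges : #|edges host| * q ^ H <=
  \sum_(i < d) \sum_tau \sum_(tau' | near i tau tau')
     layer_size tau * (layer_size tau' * q ^ (tau' i).+1).
Proof.
pose S i tau' (x : slot) :=
  [set y : slot | [&& valid y, y.1.1 == tau' & agree i x.1.1 tau' x.1.2 y.1.2]].
have deg x : #|[set y | host_adj x y]| <=
    valid x * \sum_i \sum_(tau' | near i x.1.1 tau') #|S i tau' x|.
  have [vx|vx] := boolP (valid x); last first.
    rewrite mul0n leqn0 cards_eq0; apply/eqP/setP => y.
    by rewrite !inE /host_adj (negPf vx) andbF.
  rewrite mul1n -sum1_card big_mkcond /=.
  have cS i tau' : #|S i tau' x| = \sum_y (y \in S i tau' x).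
    by rewrite -sum1_card big_mkcond.
  under [leqRHS]eq_bigr do under eq_bigr do rewrite cS.
  under [leqRHS]eq_bigr do rewrite exchange_big.
  rewrite [leqRHS]exchange_big /=; apply: leq_sum => y _; rewrite inE.
  case: ifP => // /and4P[_ _ vy /existsP[i /andP[ni ai]]].
  rewrite (bigD1 i) //= (bigD1 y.1.1) //= inE vy eqxx ai /=.
  by rewrite -addnA leq_addr.
have e1 : #|edges host| <= \sum_(x : slot) #|[set y | host_adj x y]|.
  apply: leq_trans (leq_imset_card _ _) _; rewrite -sum1_card.
  rewrite (partition_big fst predT) //=; apply: leq_sum => x _.
  rewrite sum1dep_card.
  rewrite -(@card_in_imset _ _ (fun p : slot * slot => p.2)); last first.
    by move=> [a b] [a' b']; rewrite !inE /= => /andP[_ /eqP->] /andP[_ /eqP->] ->.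
  apply/subset_leq_card/subsetP => _ /imsetP[[a b] ab ->].
  by move: ab; rewrite !inE /= => /andP[+ /eqP<-].
apply: (@leq_trans (\sum_(x : slot) valid x *
    \sum_i \sum_(tau' | near i x.1.1 tau') layer_size tau' * q ^ (tau' i).+1)).
  apply: leq_trans (leq_mul e1 (leqnn _)) _; rewrite big_distrl /=.
  apply: leq_sum => x _; apply: leq_trans (leq_mul (deg x) (leqnn _)) _.
  rewrite -mulnA leq_mul2l big_distrl /=; apply/orP; right; apply: leq_sum => i _.
  by rewrite big_distrl /=; apply: leq_sum => tau' nt; exact: card_agree.
rewrite [leqRHS]exchange_big /= (partition_big (fun x : slot => x.1.1) predT) //=.
apply: leq_sum => tau _.
under [leqRHS]eq_bigr do rewrite -big_distrr /=.
rewrite -big_distrr /=; apply: leq_trans (leq_mul (card_layer tau) (leqnn _)).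
rewrite -sum1_card big_distrl /= [leqLHS]big_mkcond [leqRHS]big_mkcond /=.
apply: leq_sum => x _; rewrite inE; case: eqP => [->|]; last by rewrite andbF.
by case: (valid x); rewrite ?mul1n ?mul0n.
Qed.

End Host.

(** Vertices with equal type and words are told apart by their index in the cell, which the bound on
    cells keeps below the capacity. The ends of an [f i]-edge share their pieces from the larger
    height on, hence also their letters. *)
Lemma host_embedding (F : sgraph) (d H r : nat)
    (cap : {ffun 'I_d -> 'I_H.+1} -> nat) (f : 'I_d -> F -> F)
    (h : 'I_d -> F -> nat) (pi : 'I_d -> nat -> F -> F)
    (lam : 'I_d -> nat -> F -> r.-tuple bool) :
  (forall x y, adj x y -> exists i, y = f i x \/ x = f i y) ->
  (forall i v, h i v <= H) ->
  (forall i v, h i v <= (h i (f i v)).+1 /\ h i (f i v) <= (h i v).+1) ->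
  (forall i l v, l < H -> h i v <= l -> h i (f i v) <= l -> pi i l v = pi i l (f i v)) ->
  (forall tau (w : {ffun 'I_d -> {ffun 'I_H -> r.-tuple bool}}),
    #|[set v | (type_of h H v == tau) && [forall i, word_of h pi H lam i v == w i]]| <= cap tau) ->
  subgraph_of F (host r #|F|.+1 cap).
Proof.
move=> f_adj h_le h_lip pi_f capP.
pose ws v : {ffun 'I_d -> {ffun 'I_H -> r.-tuple bool}} := [ffun i => word_of h pi H lam i v].
pose cell v := [set u | (type_of h H u == type_of h H v) && [forall i, word_of h pi H lam i u == ws v i]].
pose idx v := index v (enum (cell v)).
have cell_self v : v \in cell v.
  by rewrite inE eqxx; apply/forallP => i; rewrite ffunE.
have idx_lt v : idx v < #|cell v| by rewrite cardE index_mem mem_enum.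
have idx_ltF v : idx v < #|F|.+1.
  by apply: leq_trans (idx_lt v) _; apply: leqW; exact: max_card.
pose phi v : host r #|F|.+1 cap := (type_of h H v, ws v, inord (idx v)).
have phi_inj : injective phi.
  move=> u v [] et ew /(congr1 val); rewrite /= !inordK // => ei.
  have ec : cell u = cell v by rewrite /cell et ew.
  have uE : nth u (enum (cell u)) (idx u) = u by rewrite nth_index // mem_enum.
  have vE : nth u (enum (cell v)) (idx v) = v by rewrite nth_index // mem_enum.
  by rewrite -uE -[RHS]vE ec ei.
have typeE v i : type_of h H v i = h i v :> nat by rewrite ffunE inordK // ltnS.
have phi_valid v : valid cap (phi v).
  rewrite /valid /= inordK // (leq_trans (idx_lt v) (capP _ _)) andbT inE.
  apply/forallP => i; apply/forallP => j; apply/implyP; rewrite typeE => jh.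
  by rewrite !ffunE leqNgt jh.
exists phi => // x y xy.
have main i u v : v = f i u -> near i (type_of h H u) (type_of h H v) &&
    agree i (type_of h H u) (type_of h H v) (ws u) (ws v).
  move=> vE; have [l1 l2] := h_lip i u; rewrite /near !typeE vE l1 l2 /=.
  apply/forallP => j; apply/implyP; rewrite !typeE geq_max => /andP[hu hv].
  by rewrite !ffunE hu hv pi_f.
rewrite /= /host_adj !phi_valid /=; apply/andP; split.
  by apply: contraTneq xy => /phi_inj->; rewrite adj_irr.
have [i [e|e]] := f_adj x y xy; apply/existsP; exists i; first exact: main.
have /andP[n a] := main i y x e; apply/andP; split; first by move: n; rewrite /near andbC.
by move: a => /forallP a; apply/forallP => j; have := a j; rewrite maxnC eq_sym.
Qed.

(** * Layer capacities and the edge count *)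

Lemma prod_expn_compl (q d H : nat) (tau : {ffun 'I_d -> 'I_H.+1}) :
  q ^ (\sum_i tau i) * \prod_i q ^ (H - tau i) = q ^ (d * H).
Proof.
rewrite expn_sum -big_split /= mulnC expnM -[d in RHS]card_ord -prod_nat_const.
by apply: eq_bigr => i _; rewrite -expnD subnKC // -ltnS.
Qed.

(** The first term is the average use of a word tuple: about [4 * n / s ^ max] vertices of the type,
    with [n <= q ^ (d * H)], spread over [q ^ (d * H - sum)] tuples. The second is the labelling
    error. *)
Definition capacity (d H r s : nat) (tau : {ffun 'I_d -> 'I_H.+1}) : nat :=
  (4 * (2 ^ r) ^ (\sum_i tau i)) %/ s ^ (\max_i tau i) + d * (128 * s).

Lemma max_le_sum d (tau : 'I_d -> nat) : \max_i tau i <= \sum_i tau i.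
Proof. by apply/bigmax_leqP => i _; rewrite (bigD1 i) //= leq_addr. Qed.

(** The additive part of the capacity has no factor [1 / s ^ max], but [s ^ max <= q ^ sum], and the
    type has fewer word tuples by a factor [q ^ sum]. *)
Lemma layer_size_le (d H r s : nat) (tau : {ffun 'I_d -> 'I_H.+1}) :
  0 < s -> s <= 2 ^ r ->
  layer_size r (@capacity d H r s) tau * s ^ (\max_i tau i) <=
    (4 + d * (128 * s)) * (2 ^ r) ^ (d * H).
Proof.
move=> s0 sq; rewrite /layer_size /capacity -(prod_expn_compl _ tau).
set P := \prod_i _; set a := (2 ^ r) ^ _; set b := s ^ _; set c := d * _.
have h1 : (4 * a) %/ b * b <= 4 * a by exact: leq_trunc_div.
have h2 : b <= a.
  apply: (@leq_trans ((2 ^ r) ^ (\max_i tau i))).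
    by rewrite /b; case: (\max_i _) => [//|m]; rewrite leq_exp2r.
  by rewrite leq_pexp2l ?expn_gt0 // max_le_sum.
have -> : ((4 * a) %/ b + c) * P * b = ((4 * a) %/ b * b + c * b) * P by ring.
have -> : (4 + c) * (a * P) = (4 * a + c * a) * P by ring.
by rewrite leq_mul2r leq_add ?orbT // leq_mul2l h2 orbT.
Qed.

Lemma capacity_bound (R : realFieldType) (d H r s X : nat)
    (tau : {ffun 'I_d -> 'I_H.+1}) (T : nat) :
  0 < s -> T * s ^ (\max_i tau i) <= 4 * (2 ^ r) ^ (d * H) ->
  (X%:R <= T%:R * \prod_i ((2 ^+ r) ^+ (H - tau i))^-1 + (d * (128 * s))%:R :> R)%R ->
  X <= capacity r s tau.
Proof.
move=> s0; rewrite -(prod_expn_compl _ tau) /capacity; set c := d * _.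
set P := \prod_i _; set a := (2 ^ r) ^ (\sum_i _); set b := s ^ _ => hT hX.
have P0 : 0 < P by rewrite prodn_gt0 // => i; rewrite !expn_gt0.
have {}hX : X * P <= T + c * P.
  rewrite -(ler_nat R) natrD (natrM _ X) (natrM _ c).
  have PE : (\prod_(i < d) ((2 ^+ r) ^+ (H - tau i))^-1 = P%:R^-1 :> R)%R.
    by rewrite prodfV natr_prod; congr (_^-1)%R; apply: eq_bigr => i _; rewrite !natrX.
  have PR : (0 < P%:R :> R)%R by rewrite ltr0n.
  rewrite PE in hX; apply: le_trans (ler_wpM2r (ltW PR) hX) _.
  by rewrite mulrDl divfK ?gt_eqF.
rewrite addnC -leq_subLR leq_divRL ?expn_gt0 ?s0 //.
have h1 : (X - c) * P <= T by rewrite mulnBl leq_subLR addnC.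
rewrite -(leq_pmul2r P0); apply: leq_trans (_ : T * b <= _); last by rewrite -mulnA.
by rewrite mulnAC leq_mul2r h1 orbT.
Qed.

Lemma geometric_le2 (R : realFieldType) n : (\sum_(j < n) (2 ^+ j)^-1 <= 2 :> R)%R.
Proof.
suff : (\sum_(j < n) (2 ^+ j)^-1 <= 2 - 2 * (2 ^+ n)^-1 :> R)%R.
  by move=> le; apply: le_trans le _; rewrite gerBl mulr_ge0 // invr_ge0 exprn_ge0.
elim: n => [|n IH]; first by rewrite big_ord0 expr0; lra.
rewrite big_ord_recr /=; have : ((2 ^+ n)^-1 = 2 * (2 ^+ n.+1)^-1 :> R)%R.
  by rewrite exprS invfM mulVKf ?pnatr_eq0.
by lra.
Qed.

(** Cancelling [q ^ H] leaves [(q ^ H) ^ (2 * d - 1)], which is of order [n ^ (2 - 1 / d)] once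
    [(q ^ H) ^ d] is of order [n]. *)
Lemma host_edges_le (R : realFieldType) (d H e N : nat) (s := 2 ^ (d + e)) (A : nat) cap :
  (forall tau : {ffun 'I_d -> 'I_H.+1},
    layer_size (2 * e) cap tau * s ^ (\max_i tau i) <= A * (2 ^ (2 * e)) ^ (d * H)) ->
  (#|edges (host (2 * e) N cap)|%:R * ((2 ^ (2 * e)) ^ H)%:R <=
    (d * 2 ^ (3 * e) * (A * 2 ^ d) ^ 2)%:R * ((2 ^ (2 * e)) ^ H)%:R ^+ (2 * d) :> R)%R.
Proof.
move=> layerP; set q := 2 ^ (2 * e); set g := 2 ^ e.
have qE : q = g * g by rewrite /q /g mul2n -addnn expnD.
have sE : s = 2 ^ d * g by rewrite /s expnD.
pose M (tau : {ffun 'I_d -> 'I_H.+1}) := \max_i tau i.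
pose L tau := layer_size (2 * e) cap tau.
have g1 : 0 < g by rewrite expn_gt0.
have leM (tau : {ffun 'I_d -> 'I_H.+1}) i : tau i <= M tau by exact: (leq_bigmax (F := fun i => tau i : nat)).
have e1 : #|edges (host (2 * e) N cap)| * q ^ H <=
    d * 2 ^ (3 * e) * (\sum_tau L tau * g ^ M tau) ^ 2.
  apply: leq_trans (card_host_edges _ _ _) _.
  rewrite -mulnA -[X in _ <= X * _]card_ord -sum_nat_const; apply: leq_sum => i _.
  have -> : 2 ^ (3 * e) = q * g by rewrite /q /g -expnD; congr expn; lia.
  have -> : q * g * (\sum_tau L tau * g ^ M tau) ^ 2 =
      \sum_tau \sum_tau' q * g * (L tau * g ^ M tau) * (L tau' * g ^ M tau').
    rewrite -mulnn mulnA [q * g * _]big_distrr big_distrl /=; apply: eq_bigr => tau _.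
    by rewrite big_distrr.
  apply: leq_sum => tau _; rewrite [leqLHS]big_mkcond.
  apply: leq_sum => tau' _; case: ifP => // /andP[n1 n2].
  have -> : q * g * (L tau * g ^ M tau) * (L tau' * g ^ M tau') =
      L tau * (L tau' * (q * (g * g ^ M tau * g ^ M tau'))) by ring.
  rewrite !leq_mul2l -/q expnS leq_mul2l; apply/orP; right; apply/orP; right.
  (* As [q = g * g], one factor [g ^ tau' i] is charged to [tau'] and the other to [tau], whose
     height differs by at most 1. The double sum thus becomes a square. *)
  apply/orP; right; rewrite qE expnMn -expnS.
  apply: leq_mul; apply: leq_pexp2l => //.
  by apply: leq_trans n2 _; rewrite ltnS leM.
have e2 : ((\sum_tau L tau * g ^ M tau)%:R <= (A * 2 ^ d)%:R * (q ^ H)%:R ^+ d :> R)%R.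
  (* The factor [2 ^ d] that [s] has beyond [g] contributes [2 ^ (d * M tau)], at least the product
     of all [2 ^ tau i]; the sum over types then splits into [d] geometric series. *)
  have each tau : ((L tau * g ^ M tau)%:R <=
      (A * q ^ (d * H))%:R * \prod_(i < d) (2 ^+ (tau i))^-1 :> R)%R.
    rewrite prodfV ler_pdivlMr; last by rewrite prodr_gt0 // => i _; rewrite exprn_gt0.
    rewrite -expr_sum -natrX -natrM ler_nat; apply: leq_trans (layerP tau).
    rewrite -/(M tau) -/(L tau) sE expnMn mulnAC -mulnA leq_mul2l; apply/orP; right.
    rewrite leq_mul2r -expnM leq_exp2l //; apply/orP; right.
    rewrite -[X in _ <= X * _]card_ord -sum_nat_const; apply: leq_sum => i _; exact: leM.
  rewrite natr_sum; apply: le_trans (ler_sum _ (fun tau _ => each tau)) _.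
  rewrite -mulr_sumr -(bigA_distr_bigA (fun (_ : 'I_d) (j : 'I_H.+1) => (2 ^+ j)^-1 : R))%R /=.
  rewrite natrM [in leRHS]natrM -mulrA [d * H]mulnC expnM !natrX.
  rewrite -!mulrA ler_wpM2l // mulrC ler_wpM2r ?exprn_ge0 //.
  rewrite -[X in (_ <= _ ^+ X)%R]card_ord -prodr_const; apply: ler_prod => i _.
  apply/andP; split; first by rewrite sumr_ge0 // => j _; rewrite invr_ge0 exprn_ge0.
  exact: geometric_le2.
have sq : ((\sum_tau L tau * g ^ M tau)%:R ^+ 2 <=
    ((A * 2 ^ d)%:R * (q ^ H)%:R ^+ d) ^+ 2 :> R)%R.
  by rewrite ler_sqr ?nnegrE ?ler0n // mulr_ge0 // exprn_ge0.
rewrite -natrM; apply: (@le_trans _ _ (d * 2 ^ (3 * e) * (\sum_tau L tau * g ^ M tau) ^ 2)%N%:R%R).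
  by rewrite ler_nat.
rewrite natrM natrX.
rewrite [X in (_ <= X * _)%R]natrM -mulrA ler_wpM2l //.
by apply: le_trans sq _; rewrite exprMn -exprM [d * 2]mulnC [in leRHS]natrX.
Qed.

Lemma host_universal (R : realFieldType) (D d n H r s : nat) : 0 < d ->
  2 * (D.+1 + 2) <= s -> 4 * s <= 2 ^ r -> n <= (2 ^ r) ^ (d * H) ->
  universal (host r n.+1 (@capacity d H r s)) (bounded_density_family d%:R D n).
Proof.
move=> d0 s_large r_large n_le F [[cardF densF] degF].
have s0 : 0 < s by lia.
have [f [fib f_adj]] := functional_decomposition densF degF.
have /fin_all_exists[hp hpP] i : exists hp : (F -> nat) * (nat -> F -> F),
  [/\ forall v, hp.1 v <= H,
      forall v, hp.1 v <= (hp.1 (f i v)).+1 /\ hp.1 (f i v) <= (hp.1 v).+1,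
      forall l v, l < H -> hp.1 v <= l -> hp.1 (f i v) <= l -> hp.2 l v = hp.2 l (f i v),
      forall k, k <= H -> #|[set v | k <= hp.1 v]| * s ^ k <= 4 * #|F|
    & forall l t k, l < H -> k <= l ->
      #|[set v | (hp.1 v == k) && (hp.2 l v == t)]| <= 16 * s ^ (l.+1 - k)].
  by have [h [pi P]] := forest_decomposition H (fib i) s_large; exists (h, pi).
pose h i := (hp i).1; pose pi i := (hp i).2.
have h_le i v : h i v <= H by have [+ _ _ _ _] := hpP i; apply.
have h_piece i l t k : l < H -> k <= l ->
    #|[set v | (h i v == k) && (pi i l v == t)]| <= 16 * s ^ (l.+1 - k).
  by have [_ _ _ _] := hpP i; apply.
have [lam lamP] := words_exist R h_le h_piece s0 r_large.
rewrite -cardF; apply: (@host_embedding F d H r _ f h pi lam) => //.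
- by move=> i v; have [_ + _ _ _] := hpP i; apply.
- by move=> i l v; have [_ _ + _ _] := hpP i; apply.
move=> tau w; apply: (capacity_bound s0 _ (lamP tau w)).
(* In a coordinate attaining the maximum, all vertices of type [tau] are high, so the bound on high
   vertices limits their number. *)
have [|i ->] := @bigop.eq_bigmax _ (fun i => tau i : nat).
  by rewrite card_ord.
have tH : tau i <= H by rewrite -ltnS.
apply: (@leq_trans (#|[set v | tau i <= h i v]| * s ^ tau i)).
  rewrite leq_mul2r; apply/orP; right; apply/subset_leq_card/subsetP => v.
  by rewrite !inE => /eqP<-; rewrite ffunE inordK // ltnS.
have [_ _ _ hk _] := hpP i; apply: leq_trans (hk _ tH) _.
by rewrite leq_mul2l cardF n_le.
Qed.

(** * Rounding [n] up to a power and choosing the parameters *)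

Lemma up_log_expn_le q d n : 1 < q -> 0 < d -> 0 < n ->
  (q ^ up_log (q ^ d) n) ^ d <= q ^ d * n.
Proof.
move=> q1 d0 n0; have qd1 : 1 < q ^ d by rewrite -(exp1n d) ltn_exp2r.
rewrite -expnM mulnC expnM.
(* For [n > 1] the preceding power of [q ^ d] is below [n], so the overshoot is at most [q ^ d]; for
   [n = 1] the logarithm is 0. *)
have [n1|n1] := leqP n 1.
  have -> : up_log (q ^ d) n = 0 by apply/eqP; rewrite up_log_eq0 n1 orbT.
  by rewrite muln_gt0 n0 (ltnW qd1).
have := up_log_gtn qd1 n1; have := up_log_gt0 (q ^ d) n; rewrite qd1 n1.
by case: (up_log _ _) => // k _ lt; rewrite expnS leq_mul2l ltnW ?orbT.
Qed.

Unset Implicit Arguments.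
Local Open Scope ring_scope.

Theorem theorem1p5 (R : realType) (D d : nat) (d_gt0 : (0 < d)%N) :
  exists C : R, forall n : nat, exists G : sgraph,
    #|edges G|%:R <= C * n%:R `^ (2 - 1 / d%:R) /\
    universal G (bounded_density_family d%:R D n).
Proof.
Local Open Scope nat_scope.
(* This [e] meets both demands on [s]: [s >= 8 * 2 ^ D >= 2 * (D + 3)], and [4 * s <= q] since
   [d + 2 <= e]. *)
pose e := d + D + 3; pose q := 2 ^ (2 * e); pose s := 2 ^ (d + e).
pose A := 4 + d * (128 * s); pose B := d * 2 ^ (3 * e) * (A * 2 ^ d) ^ 2.
have q1 : 1 < q by rewrite -[1](expn0 2) ltn_exp2l // /e; lia.
pose p : R := (2 - 1 / d%:R)%R.
have dR : (1 <= d%:R :> R)%R by rewrite ler1n.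
have p0 : (0 <= p)%R.
  rewrite /p subr_ge0 ler_pdivrMr ?(lt_le_trans _ dR) //.
  by apply: le_trans dR _; rewrite ler_peMl ?ler1n // (le_trans _ dR).
(* The power of [q ^ d] pays for rounding [n] up. For [n = 0] a single vertex hosts the empty
   graph. *)
exists (B%:R * (q ^ d)%N%:R `^ p)%R => -[|n].
  exists (@SGraph unit (fun _ _ => false) (fun _ _ => erefl) (fun _ => erefl)); split.
    rewrite (_ : edges _ = set0) ?cards0; first by rewrite !mulr_ge0 ?powR_ge0.
    by apply/setP => E; rewrite inE; apply/imsetP => -[z]; rewrite inE.
  move=> F [[/card0_eq F0 _] _]; exists (fun=> tt) => x; by have := F0 x; rewrite inE.
pose H := up_log (q ^ d) n.+1; pose Q := q ^ H.
exists (host (2 * e) n.+2 (@capacity d H (2 * e) s)); split; last first.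
  apply: (host_universal R d_gt0).
  - have -> : s = 2 ^ (d + d) * (2 ^ D * 8).
      by rewrite /s /e -[8]/(2 ^ 3) -!expnD; congr expn; lia.
    have ltD : D < 2 ^ D by exact: ltn_expl.
    apply: (@leq_trans (1 * (2 ^ D * 8))); first by lia.
    by rewrite leq_mul2r expn_gt0 orbT.
  - by rewrite /s -[4]/(2 ^ 2) -expnD leq_exp2l // /e; lia.
  - rewrite expnM; apply: up_logP; apply: (leq_trans q1).
    by rewrite -/q -[X in X <= _]expn1; apply: leq_pexp2l => //; exact: (ltnW q1).
have Q0 : (0 < Q%:R :> R)%R by rewrite ltr0n expn_gt0 ltnW.
have s_le : s <= q by rewrite leq_exp2l // /e; lia.
have := @host_edges_le R d H e n.+2 A (@capacity d H (2 * e) s)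
  (fun tau => layer_size_le tau (expn_gt0 2 _) s_le).
rewrite -/q -/Q -/B => hE.
have {}hE : (#|edges (host (2 * e) n.+2 (@capacity d H (2 * e) s))|%:R <=
    B%:R * Q%:R ^+ (2 * d).-1 :> R)%R.
  rewrite -(ler_pM2r Q0); apply: le_trans hE _.
  by rewrite -mulrA -exprSr prednK // muln_gt0.
apply: le_trans hE _; rewrite -mulrA ler_wpM2l // -powRM //.
have -> : (Q%:R ^+ (2 * d).-1 = (Q ^ d)%N%:R `^ p :> R)%R.
  rewrite natrX -!powR_mulrn ?ler0n // -powRrM; congr (_ `^ _)%R.
  rewrite /p mulrBr mul1r divff ?gt_eqF ?(lt_le_trans _ dR) //.
  by rewrite -subn1 natrB ?muln_gt0 // natrM mulrC.
rewrite -natrM; apply: ge0_ler_powR; rewrite ?nnegrE ?ler0n // ler_nat.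
exact: up_log_expn_le.
Qed.
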